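(* Let $M$ be a smooth manifold of real dimension $4r$ and let $\varpi(\zeta)=-\frac{i}{2\zeta}\omega_++\omega_3-\frac{i}{2}\zeta\,\omega_-$, $\zeta\in\mathbb{C}^\times$, be a family of holomorphic symplectic forms on $M$ such that $\omega_+$ is a holomorphic symplectic form on $M$, $\omega_-=\overline{\omega_+}$ and $\omega_3=\overline{\omega_3}$. Then the pseudo-hyper-Kähler structure on $M$ determined by this family (the one with pseudo-Kähler forms $\omega_1,\omega_2,\omega_3$, $\omega_\pm=\omega_1\pm i\omega_2$, and metric $g$) coincides with the pseudo-hyper-Kähler structure defined by Hitchin–Karlhede–Lindström–Roček from the associated twistor space $\mathcal{Z}=M\times\mathbb{P}^1$, when $M$ is identified with the corresponding family of real holomorphic sections $\{s_m\}_{m\in M}$ of $\mathcal{Z}\to\mathbb{P}^1$.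
   Context: Holomorphic symplectic form on a real manifold $M$: a closed complex-valued 2-form $\Omega$, viewed as a map $T_{\mathbb{C}}M\to T^*_{\mathbb{C}}M$, with $T_{\mathbb{C}}M=\ker\Omega\oplus\ker\bar\Omega$; it determines a unique complex structure with $T^{(0,1)}M=\ker\Omega$, $T^{(1,0)}M=\ker\bar\Omega$. Let $J^{(\zeta)}$ be the complex structure determined by $\varpi(\zeta)$ for $\zeta\in\mathbb{C}^\times$, by $\omega_+$ for $\zeta=0$, by $\omega_-$ for $\zeta=\infty$; $M^{(\zeta)}=(M,J^{(\zeta)})$; $J_1=J^{(i)}$, $J_2=J^{(-1)}$, $J_3=J^{(0)}$. Pseudo-hyper-Kähler structure: a pseudo-Riemannian metric $g$ (nondegenerate, of any signature), symplectic forms $\omega_1,\omega_2,\omega_3$ and complex structures $J_1,J_2,J_3$ with $J_\alpha J_\beta=\sum_\gamma\epsilon_{\alpha\beta\gamma}J_\gamma-\delta_{\alpha\beta}$ and $\omega_\alpha(v,w)=g(J_\alpha v,w)$ for $\alpha=1,2,3$. The paper's structure determined by $\varpi(\zeta)$: the forms $\omega_\alpha$ and complex structures $J_\alpha$ above form a pseudo-hyper-Kähler structure with metric $$g(u,w)=\tfrac12\big(\omega_+(u,J_1w)-\omega_+(J_1u,w)\big),\qquad u,w\in T_mM.$$ (This is a known fact that may be used.) Twistor space: $\mathcal{Z}=M\times\mathbb{P}^1$ as a real manifold, with projection $p:\mathcal{Z}\to\mathbb{P}^1$, with the complex structure whose tangent space at $(m,\zeta)$ is $T_mM^{(\zeta)}\oplus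 T_\zeta\mathbb{P}^1$, with the twisted fiberwise holomorphic symplectic form $\varpi$ (a holomorphic section of $\wedge^2T^*_{(1,0)}M\otimes p^*\mathcal{O}(2)$), and with the real structure $\rho(m,\zeta)=(m,-1/\bar\zeta)$. Each $m\in M$ gives a real holomorphic section $s_m(\zeta)=(m,\zeta)$; its normal bundle is identified with $(T^{(1,0)}M)_m\to\mathbb{P}^1$, the bundle with fiber $(T^{(1,0)}M^{(\zeta)})_m$ over $\zeta$. Real holomorphic sections of $(T^{(1,0)}M)_m$: a smooth section $s$, $s(\zeta)\in(T^{(1,0)}M^{(\zeta)})_m\subset(T_{\mathbb{C}}M)_m$, is real if $\overline{s(\zeta)}=s(-1/\bar\zeta)$. It is holomorphic if it pairs holomorphically with holomorphic sections of the dual bundle $(T^*_{(1,0)}M)_m=(1-\zeta J_1')(T^*_{(1,0)}M^{(0)})_m$ (prime denotes transpose); this gives a holomorphic identification $(T^{(1,0)}M)_m\cong(T^{(1,0)}M^{(0)})_m\otimes\mathcal{O}(1)$, under which $s$ is represented over $\mathbb{C}$ by the function $v(\zeta)\in(T^{(1,0)}M^{(0)})_m$ with $\tau(v(\zeta))=\tau((1-\zeta J_1)s(\zeta))$ for all $\tau\in(T^*_{(1,0)}M^{(0)})_m$, and $s$ is holomorphic iff $v(\zeta)=a+\zeta b$ for some $a,b\in(T^{(1,0)}M^{(0)})_m$. The space of real holomorphic sections is denoted $H^0_{\mathbb{R}}((T^{(1,0)}M)_m)$. It is identified with $T_mM$ by sending a real tangent vector $u$ to the section whose value at $\zeta$ is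 the $(1,0)$-part of $u$ with respect to $J^{(\zeta)}$. Hitchin–Karlhede–Lindström–Roček structure: on the space $\widetilde M$ of real holomorphic sections of $\mathcal{Z}$ with normal bundle $\mathcal{O}(1)^{\oplus 2r}$, the tangent space at $s_m$ is $H^0_{\mathbb{R}}((T^{(1,0)}M)_m)$. There is an antilinear operator $j$ on $(T^{(1,0)}M^{(0)})_m$ with $j^2=-1$ such that the real holomorphic sections are exactly those represented by $v(\zeta)=a-\zeta\,ja$, $a\in(T^{(1,0)}M^{(0)})_m$. The metric is $$g(a-\zeta ja,\;b-\zeta jb)=\tfrac12\big(\omega_+(a,jb)-\omega_+(ja,b)\big),$$ and the complex structures and holomorphic symplectic forms on $\widetilde M$ are those obtained by pulling back, for each $\zeta$, the complex structure and the form $\varpi(\zeta)$ of the fiber $p^{-1}(\zeta)$ along the evaluation map $s\mapsto s(\zeta)$. *)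

(* Defs.v *)
(* MathComp / MathComp-Analysis; R[i] is the field of complex numbers over R. *)
From HB Require Import structures.
From mathcomp Require Import all_boot all_order all_algebra.
From mathcomp Require Import complex.
From mathcomp Require Import boolp classical_sets functions reals.
From mathcomp Require Import topology normedtype derive.

Set Implicit Arguments.
Unset Strict Implicit.
Unset Printing Implicit Defensive.

Import Order.TTheory GRing.Theory Num.Theory.
Import numFieldNormedType.Exports.

Local Open Scope classical_set_scope.
Local Open Scope ring_scope.
Local Open Scope complex_scope.

Section Smoothness.
Context {R : realType}.

(* For open U this is the usual notion of a C^k function in finite dimension:
   all iterated directional derivatives up to order k exist and are
   continuous on U. *)
Fixpoint Ck_on {V W : normedModType R} (k : nat) (U : set V) (f : V -> W) : Prop :=
  (forall x, U x -> {for x, continuous f}) /\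
  (if k is k'.+1 then
     forall v, (forall x, U x -> derivable f x v) /\ Ck_on k' U ('D_v f)
   else True).

Definition smooth_on {V W : normedModType R} (U : set V) (f : V -> W) : Prop :=
  forall k, Ck_on k U f.

Definition csmooth_on {V : normedModType R} (U : set V) (f : V -> R[i]) : Prop :=
  smooth_on U (fun x => complex.Re (f x)) /\
  smooth_on U (fun x => complex.Im (f x)).

Definition cderive {V : normedModType R} (v : V) (f : V -> R[i]) (x : V) : R[i] :=
  'D_v (fun x => complex.Re (f x)) x +i* 'D_v (fun x => complex.Im (f x)) x.

End Smoothness.

(* A smooth structure is given by an atlas containing, for every point x, a
   chart phi x : cdom x -> R^n around x with inverse psi x.  Every smooth
   structure has such an atlas and is determined by it. *)
Record smoothManifold (R : realType) (n : nat) := SmoothManifold {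
  carrier :> topologicalType ;
  carrier_hausdorff : hausdorff_space carrier ;
  carrier_second_countable : @second_countable carrier ;
  cdom : carrier -> set carrier ;
  phi : carrier -> carrier -> 'rV[R]_n ;
  psi : carrier -> 'rV[R]_n -> carrier ;
  cdom_open : forall x, open (cdom x) ;
  cdom_center : forall x, cdom x x ;
  cod_open : forall x, open (phi x @` cdom x) ;
  phi_continuous : forall x y, cdom x y -> {for y, continuous (phi x)} ;
  psi_continuous : forall x v, (phi x @` cdom x) v -> {for v, continuous (psi x)} ;
  phiK : forall x y, cdom x y -> psi x (phi x y) = y ;
  transition_smooth : forall x y,
    smooth_on (phi x @` (cdom x `&` cdom y)) (phi y \o psi x)
}.

Section Geometry.
Context {R : realType}.
Local Notation C := R[i].

Definition toC {m n : nat} (A : 'M[R]_(m, n)) : 'M[C]_(m, n) :=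
  map_mx (real_complex R) A.
Definition conjM {m n : nat} (A : 'M[C]_(m, n)) : 'M[C]_(m, n) := map_mx conjc A.

(* The tangent space T_x M is 'rV[R]_n, read in the chart phi x, and its
   complexification is 'rV[C]_n.  A complex bilinear form on it is a matrix B,
   with B(u, w) = u B w^T, and u *m B is the covector B(u, -).  An endomorphism
   acts on row vectors from the right. *)
Definition bil {n : nat} (B : 'M[C]_n) (u w : 'rV[C]_n) : C := (u *m B *m w^T) 0 0.

Definition formField n (M : smoothManifold R n) := forall x : M, 'M[C]_n.

(* The matrix of w at psi m y in the coordinates phi m: the Jacobian sends
   coordinate vectors of phi m to T_(psi m y) M. *)
Definition local_form n (M : smoothManifold R n) (w : formField M) (m : M)
    (y : 'rV[R]_n) : 'M[C]_n :=
  let A := toC (jacobian (phi (psi m y) \o psi m) y) in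
  A *m w (psi m y) *m A^T.

Definition smooth_form n (M : smoothManifold R n) (w : formField M) : Prop :=
  forall (m : M) (i j : 'I_n),
    csmooth_on (phi m @` cdom m) (fun y => local_form w m y i j).

Definition closed_form n (M : smoothManifold R n) (w : formField M) : Prop :=
  forall (m : M) (y : 'rV[R]_n), (phi m @` cdom m) y -> forall i j k : 'I_n,
      cderive (delta_mx 0 i) (fun y => local_form w m y j k) y
    + cderive (delta_mx 0 j) (fun y => local_form w m y k i) y
    + cderive (delta_mx 0 k) (fun y => local_form w m y i j) y = 0.

Definition closed_two_form n (M : smoothManifold R n) (w : formField M) : Prop :=
  [/\ smooth_form w, forall x, (w x)^T = - w x & closed_form w].

(* T^(0,1) = ker B and T^(1,0) = ker (conj B), as row spaces. *)
Definition T01 {n : nat} (B : 'M[C]_n) : 'M[C]_n := kermx B.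
Definition T10 {n : nat} (B : 'M[C]_n) : 'M[C]_n := kermx (conjM B).

Definition splits {n : nat} (B : 'M[C]_n) : bool :=
  row_full (T01 B + T10 B)%MS && ((T01 B :&: T10 B)%MS == 0).

Definition holomorphic_symplectic n (M : smoothManifold R n) (w : formField M) : Prop :=
  closed_two_form w /\ forall x, splits (w x).

(* Projections of T_C M onto T^(1,0) along T^(0,1) and vice versa. *)
Definition pr10 {n : nat} (B : 'M[C]_n) : 'M[C]_n := proj_mx (T10 B) (T01 B).
Definition pr01 {n : nat} (B : 'M[C]_n) : 'M[C]_n := proj_mx (T01 B) (T10 B).

(* The complex structure determined by B: multiplication by i on T^(1,0) and
   by -i on T^(0,1) (see cplx_structureP). *)
Definition cplx_structure {n : nat} (B : 'M[C]_n) : 'M[R]_n :=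
  map_mx (@complex.Re R) ('i%C *: pr10 B - 'i%C *: pr01 B).

Lemma row_full_eq n (A D : 'M[C]_n) (X Y : 'M[C]_n) :
  row_full (A + D)%MS -> A *m X = A *m Y -> D *m X = D *m Y -> X = Y.
Proof.
rewrite -sub1mx => fullAD eA eD; apply/subr0_eq.
have sub0 (E : 'M[C]_n) : E *m X = E *m Y -> (E <= kermx (X - Y))%MS.
  by move=> e; apply/sub_kermxP; rewrite mulmxBr e subrr.
have /sub_kermxP : (1%:M <= kermx (X - Y))%MS.
  by rewrite (submx_trans fullAD) // addsmx_sub !sub0.
by rewrite mul1mx.
Qed.

Lemma conjMM n m p (A : 'M[C]_(n, m)) (D : 'M[C]_(m, p)) : conjM (A *m D) = conjM A *m conjM D.
Proof. exact: map_mxM. Qed.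
Lemma conjMZ n m (a : C) (A : 'M[C]_(n, m)) : conjM (a *: A) = conjc a *: conjM A.
Proof. exact: map_mxZ. Qed.
Lemma conjMK n m (A : 'M[C]_(n, m)) : conjM (conjM A) = A.
Proof. by apply/matrixP => i j; rewrite !mxE; case: (A i j) => a b /=; rewrite opprK. Qed.
Lemma conj_kermx n m (A : 'M[C]_(n, m)) : conjM (kermx A) = kermx (conjM A).
Proof. exact: map_kermx. Qed.

Lemma toC_Re n m (X : 'M[C]_(n, m)) : conjM X = X -> toC (map_mx (@complex.Re R) X) = X.
Proof.
move/matrixP=> cX; apply/matrixP => i j; move: (cX i j); rewrite !mxE.
case: (X i j) => a b [] /eqP; rewrite eq_sym -addr_eq0 -mulr2n mulrn_eq0 /=.
by move/eqP->.
Qed.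
Lemma toC_inj n m (X Y : 'M[R]_(n, m)) : toC X = toC Y -> X = Y.
Proof. by move/matrixP => e; apply/matrixP => i j; move: (e i j); rewrite !mxE => -[]. Qed.

Lemma cplx_structure_aux n (E F P Q : 'M[C]_n) (J : 'M[R]_n) :
  row_full (F + E)%MS -> conjM E = F -> conjM F = E ->
  E *m P = E -> E *m Q = 0 -> F *m P = 0 -> F *m Q = F ->
  J = map_mx (@complex.Re R) ('i%C *: P - 'i%C *: Q) <->
  E *m toC J = 'i%C *: E /\ F *m toC J = - 'i%C *: F.
Proof.
move=> full cE cF EP EQ FP FQ; set X := 'i%C *: P - 'i%C *: Q.
have XE : E *m X = 'i%C *: E.
  by rewrite mulmxBr -!scalemxAr EP EQ scaler0 subr0.
have XF : F *m X = - 'i%C *: F.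
  by rewrite mulmxBr -!scalemxAr FP FQ scaler0 sub0r scaleNr.
have conji : conjc 'i%C = - 'i%C :> C by apply/eqP; rewrite eq_complex /= oppr0 !eqxx.
have conjNi : conjc (- 'i%C) = 'i%C :> C by apply/eqP; rewrite eq_complex /= !oppr0 opprK !eqxx.
have XJ : toC (map_mx (@complex.Re R) X) = X.
  apply: toC_Re; apply: (row_full_eq full).
    by rewrite -[in LHS]cE -conjMM XE conjMZ cE XF conji.
  by rewrite -[in LHS]cF -conjMM XF conjMZ cF XE conjNi.
split=> [-> | [JE JF]]; first by rewrite XJ.
by apply: toC_inj; apply: (row_full_eq full); rewrite XJ ?JF ?JE ?XF ?XE.
Qed.

Lemma cplx_structureP n (B : 'M[C]_n) (J : 'M[R]_n) : splits B ->
  J = cplx_structure B <->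
  T10 B *m toC J = 'i%C *: T10 B /\ T01 B *m toC J = - 'i%C *: T01 B.
Proof.
case/andP=> full /eqP cap0; have cap0' := cap0; rewrite capmxC in cap0'.
apply: cplx_structure_aux full _ _ _ _ _ _.
- by rewrite conj_kermx conjMK.
- exact: conj_kermx.
- exact: proj_mx_id cap0' (submx_refl _).
- exact: proj_mx_0 cap0 (submx_refl _).
- exact: proj_mx_0 cap0' (submx_refl _).
- exact: proj_mx_id cap0 (submx_refl _).
Qed.
(* P^1 = C + {oo}, with its two standard affine charts. *)
Definition P1 := option C.
Definition aff (z : C) : P1 := Some z.
Definition affoo (w : C) : P1 := if w == 0 then None else Some w^-1.

Definition antipode (zeta : P1) : P1 :=
  match zeta with
  | None => Some 0
  | Some z => if z == 0 then None else Some (- (conjc z)^-1)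
  end.

(* varpi(zeta); at 0 and oo it is replaced by its leading coefficient, up to a
   scalar, i.e. by the value of the O(2)-twisted form. *)
Definition pencil {V : lmodType C} (wp w3 wm : V) (zeta : P1) : V :=
  match zeta with
  | None => wm
  | Some z => if z == 0 then wp
              else (- ('i%C / (2 * z))) *: wp + w3 - (('i%C * z) / 2) *: wm
  end.

Definition standard_chart (c : C -> P1) : Prop := c = aff \/ c = affoo.

Definition plane (p : R * R) : C := p.1 +i* p.2.

(* A pseudo-hyper-Kaehler structure at one point: a metric, the forms omega_1,
   omega_2, omega_3 and the whole sphere of complex structures on a space of
   tangent vectors. *)
Record hkData (V : Type) := HkData {
  hk_metric : V -> V -> C ;
  hk_omega1 : V -> V -> C ;
  hk_omega2 : V -> V -> C ;
  hk_omega3 : V -> V -> C ;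
  hk_cplx : P1 -> V -> V
}.

Definition hk_varpi (V : Type) (D : hkData V) (zeta : P1) (u w : V) : C :=
  pencil (V := C^o)
    (hk_omega1 D u w + 'i%C * hk_omega2 D u w) (hk_omega3 D u w)
    (hk_omega1 D u w - 'i%C * hk_omega2 D u w) zeta.

(* f identifies E with (the restriction to its range of) D. *)
Definition hk_coincide (V W : Type) (f : V -> W) (E : hkData V) (D : hkData W) : Prop :=
  [/\ forall u w, hk_metric D (f u) (f w) = hk_metric E u w,
      forall u w, hk_omega1 D (f u) (f w) = hk_omega1 E u w,
      forall u w, hk_omega2 D (f u) (f w) = hk_omega2 E u w,
      forall u w, hk_omega3 D (f u) (f w) = hk_omega3 E u w &
      forall zeta u, hk_cplx D zeta (f u) = f (hk_cplx E zeta u)].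

Section Family.
Context {n : nat} {M : smoothManifold R n}.
Variables (wp w3 wm : formField M).

Definition varpi (zeta : P1) : formField M := fun x => pencil (wp x) (w3 x) (wm x) zeta.

Definition Jz (zeta : P1) (x : M) : 'M[R]_n := cplx_structure (varpi zeta x).

Definition J1 := Jz (aff 'i%C).
Definition J2 := Jz (aff (-1)).
Definition J3 := Jz (aff 0).

(* omega_+ = omega_1 + i omega_2 and omega_- = omega_1 - i omega_2. *)
Definition w1 : formField M := fun x => 2^-1 *: (wp x + wm x).
Definition w2 : formField M := fun x => (2 * 'i%C)^-1 *: (wp x - wm x).

(* g(u, w) = (omega_+(u, J1 w) - omega_+(J1 u, w)) / 2 *)
Definition gM : formField M := fun x =>
  2^-1 *: (wp x *m (toC (J1 x))^T - toC (J1 x) *m wp x).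

Definition paper_structure (x : M) : hkData 'rV[R]_n := HkData
  (fun u w => bil (gM x) (toC u) (toC w))
  (fun u w => bil (w1 x) (toC u) (toC w))
  (fun u w => bil (w2 x) (toC u) (toC w))
  (fun u w => bil (w3 x) (toC u) (toC w))
  (fun zeta u => u *m Jz zeta x).

(* The twistor space.  The complex structure of Z at (x, zeta) acts on
   T_x M + T_zeta P^1, the second summand being C by means of a chart. *)
Definition Z := (M * P1)%type.
Definition JZ (p : Z) (v : 'rV[R]_n * C) : 'rV[R]_n * C := (v.1 *m Jz p.2 p.1, 'i%C * v.2).
Definition rho (p : Z) : Z := (p.1, antipode p.2).

(* In a chart c of P^1, a section zeta |-> (f zeta, zeta) of Z is smooth, and
   its differential h |-> (df h, h) intertwines the complex structures. *)
Definition holomorphic_section_Z (s : P1 -> Z) : Prop :=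
  (forall zeta, (s zeta).2 = zeta) /\
  forall c, standard_chart c -> forall p : R * R,
    let x := (s (c (plane p))).1 in
    let f := fun q : R * R => (s (c (plane q))).1 in
    let F := phi x \o f in
    let ds := fun h : C => ('D_(complex.Re h, complex.Im h) F p, h) in
    [/\ {for p, continuous f},
        exists2 U, nbhs p U & open U /\ smooth_on U F &
        forall h : C, ds ('i%C * h) = JZ (s (c (plane p))) (ds h)].

Definition real_section_Z (s : P1 -> Z) : Prop :=
  forall zeta, s (antipode zeta) = rho (s zeta).

Definition sM (x : M) : P1 -> Z := fun zeta => (x, zeta).

Section Point.
Variable x : M.
Local Notation J1C := (toC (J1 x)).
Local Notation T10_ zeta := (T10 (varpi zeta x)).

(* Covectors of type (1,0) for J^(0): they vanish on T^(0,1).  A covector tau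
   is a column, tau(u) = u *m tau, and J1' tau is J1 *m tau. *)
Definition cotangent10 (tau : 'cV[C]_n) : Prop := T01 (wp x) *m tau = 0.

(* Sections of the normal bundle (T^(1,0) M)_x of s_x. *)
Definition normal_section (s : P1 -> 'rV[C]_n) : Prop :=
  (forall zeta, (s zeta <= T10_ zeta)%MS) /\
  forall c, standard_chart c -> forall k : 'I_n,
    csmooth_on setT (fun p : R * R => s (c (plane p)) 0 k).

Definition real_section (s : P1 -> 'rV[C]_n) : Prop :=
  forall zeta, conjM (s zeta) = s (antipode zeta).

(* The covectors (1 - z J1') tau are a holomorphic frame of the dual bundle
   over C, and the covectors z^-1 (1 - z J1') tau = (w - J1') tau, w = 1/z, are
   one over P^1 \ {0}; tau ranges over T*_(1,0) M^(0). *)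
Definition dual_frame0 (z : C) (tau : 'cV[C]_n) : 'cV[C]_n := tau - z *: (J1C *m tau).
Definition dual_frameoo (w : C) (tau : 'cV[C]_n) : 'cV[C]_n := w *: tau - J1C *m tau.

Definition holomorphic_section (s : P1 -> 'rV[C]_n) : Prop :=
  forall tau, cotangent10 tau ->
    (forall z : C^o,
       derivable (fun z : C^o => (s (aff z) *m dual_frame0 z tau) 0 0 : C^o) z 1) /\
    (forall w : C^o,
       derivable (fun w : C^o => (s (affoo w) *m dual_frameoo w tau) 0 0 : C^o) w 1).

(* H^0_R((T^(1,0) M)_x), the tangent space at s_x of the space of real
   holomorphic sections of Z. *)
Definition H0R : set (P1 -> 'rV[C]_n) :=
  [set s | [/\ normal_section s, real_section s & holomorphic_section s]].

(* The identification T_x M -> H0R. *)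
Definition tangent_section (u : 'rV[R]_n) : P1 -> 'rV[C]_n :=
  fun zeta => toC u *m pr10 (varpi zeta x).

Definition represented_by (s : P1 -> 'rV[C]_n) (v : C -> 'rV[C]_n) : Prop :=
  forall z, (v z <= T10 (wp x))%MS /\
    forall tau, cotangent10 tau ->
      v z *m tau = (s (aff z) - z *: (s (aff z) *m J1C)) *m tau.

(* The normal bundle is T^(1,0) M^(0) (x) O(1), with T^(1,0) M^(0) of dimension
   d: the fibrewise map s |-> v is invertible in both trivializations. *)
Definition normal_bundle_O1 (d : nat) : Prop :=
  [/\ \rank (T10 (wp x)) = d,
      forall z (v : 'rV[C]_n), (v <= T10 (wp x))%MS ->
        exists! y : 'rV[C]_n, (y <= T10_ (aff z))%MS /\
          forall tau, cotangent10 tau -> v *m tau = y *m dual_frame0 z tau &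
      forall w (v : 'rV[C]_n), (v <= T10 (wp x))%MS ->
        exists! y : 'rV[C]_n, (y <= T10_ (affoo w))%MS /\
          forall tau, cotangent10 tau -> v *m tau = y *m dual_frameoo w tau].

(* On T^(1,0) M^(0), j is antilinear of square -1, and the real holomorphic
   sections are exactly those represented by some a - zeta j a. *)
Definition hklr_operator (j : 'rV[C]_n -> 'rV[C]_n) : Prop :=
  [/\ forall a, (a <= T10 (wp x))%MS -> (j a <= T10 (wp x))%MS,
      forall (l : C) a b, (a <= T10 (wp x))%MS -> (b <= T10 (wp x))%MS ->
        j (l *: a + b) = conjc l *: j a + j b,
      forall a, (a <= T10 (wp x))%MS -> j (j a) = - a,
      forall s, normal_section s ->
        (H0R s <-> exists2 a, (a <= T10 (wp x))%MS &
                     represented_by s (fun z => a - z *: j a)) &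
      forall a, (a <= T10 (wp x))%MS ->
        exists2 s, H0R s & represented_by s (fun z => a - z *: j a)].

(* The Hitchin-Karlhede-Lindstroem-Rocek structure on the tangent space H0R:
   evaluation at zeta maps it to T^(1,0)_x M^(zeta), whose complex structure is
   multiplication by i and which carries the form varpi(zeta). *)
Definition hklr_structure (D : hkData (P1 -> 'rV[C]_n)) : Prop :=
  [/\ exists2 j, hklr_operator j &
        forall s t a b, H0R s -> H0R t ->
          (a <= T10 (wp x))%MS -> (b <= T10 (wp x))%MS ->
          represented_by s (fun z => a - z *: j a) ->
          represented_by t (fun z => b - z *: j b) ->
          hk_metric D s t = 2^-1 * (bil (wp x) a (j b) - bil (wp x) (j a) b),
      forall zeta s t, H0R s -> H0R t ->
        hk_varpi D zeta s t = bil (varpi zeta x) (s zeta) (t zeta) &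
      forall zeta s, H0R s ->
        H0R (hk_cplx D zeta s) /\ hk_cplx D zeta s zeta = 'i%C *: s zeta].

End Point.
End Family.

(* Real symplectic form. *)
Definition symplectic_form n (M : smoothManifold R n) (w : formField M) : Prop :=
  closed_two_form w /\ forall x, conjM (w x) = w x /\ w x \in unitmx.

(* A pseudo-Riemannian metric g, symplectic forms o_a and complex structures
   I_a with the quaternionic relations and o_a(v, w) = g(I_a v, w).  As
   endomorphisms act from the right, the composite I_a o I_b is I_b *m I_a.
   The relations express g and the I_a smoothly through the o_a, and closedness
   of the o_a makes the I_a integrable. *)
Definition pseudo_hyperkaehler n (M : smoothManifold R n) (g o1 o2 o3 : formField M)
    (I1 I2 I3 : M -> 'M[R]_n) : Prop :=
  [/\ forall x, [/\ conjM (g x) = g x, (g x)^T = g x & g x \in unitmx],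
      [/\ symplectic_form o1, symplectic_form o2 & symplectic_form o3],
      forall x, [/\ I1 x *m I1 x = - 1%:M, I2 x *m I2 x = - 1%:M & I3 x *m I3 x = - 1%:M],
      forall x, [/\ I2 x *m I1 x = I3 x, I3 x *m I2 x = I1 x & I1 x *m I3 x = I2 x] /\
        [/\ I1 x *m I2 x = - I3 x, I2 x *m I3 x = - I1 x & I3 x *m I1 x = - I2 x] &
      forall x, [/\ o1 x = toC (I1 x) *m g x, o2 x = toC (I2 x) *m g x &
        o3 x = toC (I3 x) *m g x]].

End Geometry.

(* Main.v *)
Require Import Defs.
From HB Require Import structures.
From mathcomp Require Import all_boot all_order all_algebra.
From mathcomp Require Import complex.
From mathcomp Require Import boolp classical_sets functions reals.
From mathcomp Require Import topology normedtype derive.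
From mathcomp Require Import prodnormedzmodule interval_inference ring lra.

Import Order.TTheory GRing.Theory Num.Theory.
Import numFieldNormedType.Exports.
Local Open Scope classical_set_scope.
Local Open Scope ring_scope.
Local Open Scope complex_scope.

Set Implicit Arguments.
Unset Strict Implicit.
Unset Printing Implicit Defensive.

(* A split antisymmetric form B = X + iY with X, Y real has X and Y
   invertible, and on row vectors its complex structure is X Y^-1.  As the
   pencil is w_+ = w1 + i w2 at 0, w3 + i w1 at -1 and w3 - i w2 at i, this gives
   J3 = w1 w2^-1, J2 = w3 w1^-1 and J1 = w2 w3^-1, and the quaternionic relations
   follow from J_a^2 = -1 alone.

   The space T^(1,0) M^(zeta) is the image of T^(1,0) M^(0) under
   1 + conj(zeta) J1, so that the section of a real vector u with (1,0)-part a at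
   zeta = 0 is represented by a - zeta conj(a) J1; hence j a = conj(a) J1.
   Conversely, pairing a holomorphic section with the frames of the dual bundle
   yields an entire f such that w f(1/w) is differentiable at w = 0.  Such an f is
   affine: after subtraction of an affine function it vanishes at infinity, and its
   real and imaginary parts are zero by the maximum principle for harmonic
   functions.  Reality at 0 and infinity fixes the slope.  A real holomorphic section
   is thus determined by its value at any single zeta, which pins down the forms and
   the complex structures on the space of sections. *)

(** * Second derivatives and smooth functions *)

Section SecondDerivatives.
Context {R : realType} {V : normedModType R}.
Implicit Types (F : V -> R) (x y a b : V) (s t : R).

(** The obstacle is that the projection onto T^(1,0) M^(zeta) depends on conj(zeta) as well as on
    zeta, so holomorphy cannot be read off the components of a section. The covectors (1 - zeta J1')
    tau annihilate T^(0,1) M^(zeta); paired with them, a real vector can stand for its own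
    (1,0)-part, and conj(zeta) disappears. On T^(1,0) M^(0), modulo T^(0,1) M^(0), the product of 1
    + conj(zeta) J1 and 1 - zeta J1 is 1 + |zeta|^2. As this never vanishes, a section is recovered
    from its representative by an explicit formula, from which its smoothness in both charts is read
    off.

    The maximum principle is enough for the entire functions that occur, because sections are smooth
    by definition: second derivatives exist and are continuous from the start.

    The comparison concerns every structure satisfying the twistor conditions. The operator in the
    metric condition is then unknown, but the two coefficients of an affine representative are
    unique, which fixes its value wherever the metric uses it. The three forms are recovered from
    the pencil at 0, -1 and infinity. *)

Lemma is_derive_line F x a s : derivable F (x + s *: a) a ->
  is_derive s 1 (fun h => F (x + h *: a)) ('D_a F (x + s *: a)).
Proof.
move=> dF; have e : (fun h : R => h^-1 *: (((fun h => F (x + h *: a)) \o shift s) (h *: (1 : R))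
    - F (x + s *: a))) =
   (fun h : R => h^-1 *: ((F \o shift (x + s *: a)) (h *: a) - F (x + s *: a))).
  apply/funext => h /=; congr (_ *: (F _ - _)).
  by rewrite [_ *: 1]mulr1 scalerDl addrCA.
by split; [rewrite /derivable e | rewrite /derive e].
Qed.

Lemma MVT_line F x a t : 0 < t -> (forall y, derivable F y a) ->
  exists2 s, 0 < s < t & F (x + t *: a) - F x = t * 'D_a F (x + s *: a).
Proof.
move=> t0 dF; have d s : is_derive s 1 (fun h => F (x + h *: a)) ('D_a F (x + s *: a)).
  exact/is_derive_line.
have cF : {within `[0, t], continuous (fun h => F (x + h *: a))}.
  by apply: derivable_within_continuous => s _; exact: ex_derive.
have [c] := MVT t0 (fun s _ => d s) cF.
by rewrite in_itv /= scale0r addr0 subr0 => c0t ->; exists c; rewrite // mulrC.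
Qed.

(** The double difference is the increment along [a] of y |-> F (y + t b) - F y. The mean value
    theorem is applied to this function along [a], then to ['D_a F] along [b]. *)
Lemma mixed_difference F x a b t : 0 < t ->
  (forall y, derivable F y a) -> (forall y, derivable ('D_a F) y b) ->
  exists s s', [/\ 0 < s < t, 0 < s' < t &
    F (x + t *: a + t *: b) - F (x + t *: a) - (F (x + t *: b) - F x) =
    t ^+ 2 * 'D_b ('D_a F) (x + s *: a + s' *: b)].
Proof.
move=> t0 dF ddF; pose G y := F (y + t *: b) - F y.
have dG y : is_derive y a G ('D_a F (y + t *: b) - 'D_a F y).
  have dFs : is_derive y a (F \o shift (t *: b)) ('D_a F (y + t *: b)).
    have e : (fun h : R => h^-1 *: (((F \o shift (t *: b)) \o shift y) (h *: a)
        - (F \o shift (t *: b)) y)) =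
       (fun h : R => h^-1 *: ((F \o shift (y + t *: b)) (h *: a) - F (y + t *: b))).
      by apply/funext => h /=; rewrite addrA.
    by split; [rewrite /derivable e; apply: dF | rewrite /derive e].
  have dFy : is_derive y a F ('D_a F y) by apply: derivableP.
  exact: is_deriveB.
have [s s0t e1] := @MVT_line G x a t t0 (fun y => @ex_derive _ _ _ _ _ _ _ (dG y)).
have [s' s0t' e2] := @MVT_line ('D_a F) (x + s *: a) b t t0 ddF.
exists s, s'; split => //.
move: e1; rewrite (@derive_val _ _ _ _ _ _ _ (dG _)) e2 /G addrAC => ->.
by rewrite mulrA -expr2.
Qed.

(** The estimate is uniform in the base point [y], so that differences centred at [x], which start
    at x - t a, are covered too. *)
Lemma mixed_difference_near F x a b (e : R) : 0 < e ->
  (forall y, derivable F y a) -> (forall y, derivable ('D_a F) y b) ->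
  {for x, continuous ('D_b ('D_a F))} ->
  exists2 d, 0 < d & forall y t, 0 < t < d -> `|y - x| < d ->
    `|F (y + t *: a + t *: b) - F (y + t *: a) - (F (y + t *: b) - F y)
      - t ^+ 2 * 'D_b ('D_a F) x| <= t ^+ 2 * e.
Proof.
move=> e0 dF ddF /cvgrPdist_lt /(_ _ e0); rewrite -nbhs_nearE => /nbhs_ballP [r /= r0 Hr].
pose N := 1 + `|a| + `|b|; have N0 : 0 < N by rewrite /N -addrA ltr_pwDl.
(* With |y - x|, [s] and [s'] below r / N, the intermediate point stays within (r / N)(1 + |a| +
   |b|) = r of [x]. *)
exists (r / N) => [|y t /andP[t0 td] yd]; first exact: divr_gt0.
have [s [s' [/andP[s0 st] /andP[s0' st'] ->]]] := mixed_difference y t0 dF ddF.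
rewrite -mulrBr normrM ger0_norm ?sqr_ge0 // ler_wpM2l ?sqr_ge0 // ltW // distrC.
apply: Hr; rewrite -ball_normE /= distrC.
rewrite (_ : _ - x = (y - x) + (s *: a + s' *: b)); last first.
  by rewrite -!addrA; congr (y + _); rewrite addrA addrC.
rewrite (le_lt_trans (ler_normD _ _)) //.
apply: (@lt_le_trans _ _ (r / N + (r / N) * (`|a| + `|b|))); last first.
  by rewrite -[X in X + _]mulr1 -mulrDr addrA mulfVK // gt_eqF.
apply: ltr_leD => //; rewrite (le_trans (ler_normD _ _)) // mulrDr.
by rewrite !normrZ !(gtr0_norm s0, gtr0_norm s0') lerD // ler_wpM2r // ltW //
  (lt_trans _ td).
Qed.

(** Schwarz' theorem: the double difference is symmetric in [a] and [b], and both mixed derivatives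
    approximate its quotient by t^2. *)
Lemma derive_comm F x a b :
  (forall y, derivable F y a) -> (forall y, derivable ('D_a F) y b) ->
  (forall y, derivable F y b) -> (forall y, derivable ('D_b F) y a) ->
  {for x, continuous ('D_b ('D_a F))} -> {for x, continuous ('D_a ('D_b F))} ->
  'D_b ('D_a F) x = 'D_a ('D_b F) x.
Proof.
move=> Fa Fab Fb Fba cab cba; apply/eqP; rewrite -subr_eq0 -normr_le0.
apply/ler_addgt0Pl => e e0; rewrite addr0; have e20 : 0 < e / 2 by rewrite divr_gt0.
have [d d0 Hd] := mixed_difference_near e20 Fa Fab cab.
have [d' d0' Hd'] := mixed_difference_near e20 Fb Fba cba.
pose t := Num.min d d' / 2.
have m0 : 0 < Num.min d d' by rewrite lt_min d0.
have t0 : 0 < t by rewrite divr_gt0.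
have tm : t < Num.min d d' by rewrite /t ltr_pdivrMr // ltr_pMr // ltr1n.
move: tm; rewrite lt_min => /andP[td td'].
have := Hd x t; have := Hd' x t; rewrite t0 td td' subrr normr0 => /(_ isT d0') H' /(_ isT d0) H.
rewrite -(ler_pM2l (exprn_gt0 2 t0)) -[X in X * `|_|]ger0_norm ?sqr_ge0 // -normrM.
rewrite [e in leRHS]splitr [in leRHS]mulrDr.
apply: le_trans _ (lerD H' H); rewrite [leRHS]addrC -[X in _ <= X + _]normrN.
apply: le_trans _ (ler_normD _ _); rewrite le_eqVlt; apply/orP; left; apply/eqP; congr (`|_|).
rewrite (addrAC x (t *: b)); clearbody t.
move: (F _) (F _) (F _) (F x) ('D_b _ x) ('D_a _ x) => A B C D P Q; ring.
Qed.

(** At a maximum the centred difference F (x + t a) - 2 F x + F (x - t a) is nonpositive, and it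
    equals t^2 times the second derivative up to t^2 e. *)
Lemma derive2_local_max F x a (d : R) : 0 < d ->
  (forall y, derivable F y a) -> (forall y, derivable ('D_a F) y a) ->
  {for x, continuous ('D_a ('D_a F))} ->
  (forall y, `|y - x| < d -> F y <= F x) -> 'D_a ('D_a F) x <= 0.
Proof.
move=> d0 Fa Faa caa Fmax; apply/ler_addgt0Pl => e e0; rewrite addr0.
have [d' d0' Hd] := mixed_difference_near e0 Fa Faa caa.
(* Through [m], the displacement t a is shorter than both radii; the sum 1 + |a| avoids dividing by
   zero when [a] is 0. *)
pose m := Num.min d d' / (1 + `|a|); pose t := Num.min m d' / 2.
have N0 : 0 < 1 + `|a| by rewrite ltr_pwDl.
have M0 : 0 < Num.min d d' by rewrite lt_min d0.
have m0 : 0 < m by rewrite divr_gt0.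
have mm0 : 0 < Num.min m d' by rewrite lt_min m0.
have t0 : 0 < t by rewrite divr_gt0.
have tm : t < Num.min m d' by rewrite /t ltr_pdivrMr // ltr_pMr // ltr1n.
move: tm; rewrite lt_min => /andP[tm td'].
have tam : t * `|a| < Num.min d d'.
  move: tm; rewrite /m ltr_pdivlMr // mulrDr mulr1 => /(le_lt_trans _) -> //.
  by rewrite lerDr ltW.
move: tam; rewrite lt_min => /andP[tad tad'].
have na : `|t *: a| = t * `|a| by rewrite normrZ gtr0_norm.
have H2 : F (x + t *: a) <= F x by apply: Fmax; rewrite addrAC subrr add0r na.
have H3 : F (x - t *: a) <= F x by apply: Fmax; rewrite addrAC subrr add0r normrN na.
rewrite -(ler_pM2l (exprn_gt0 2 t0)).
have := Hd (x - t *: a) t; rewrite t0 td' addrAC subrr add0r normrN na tad' => /(_ isT isT).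
rewrite subrK ler_norml => /andP[H4 _]; lra.
Qed.

End SecondDerivatives.

Lemma is_derive_affine (K : numFieldType) (V W : normedModType K) (f : V -> W) x v c :
  (forall h : K, f (h *: v + x) - f x = h *: c) -> is_derive x v f c.
Proof.
move=> fc; have lim_c : (fun h : K => h^-1 *: ((f \o shift x) (h *: v) - f x)) @ 0^' --> c.
  apply: cvg_near_cst; rewrite near_withinE; apply: nearW => h h0.
  by rewrite /= fc scalerA mulVf // scale1r.
by split; [apply/cvg_ex; exists c | apply: cvg_lim lim_c; exact: norm_hausdorff].
Qed.

(** * Closure properties of C^k and smooth functions *)

Section Smooth.
Context {R : realType} {V : normedModType R}.
Implicit Types (f g : V -> R) (k : nat) (U : set V).

Lemma Ck_onW k U f : Ck_on k.+1 U f -> Ck_on k U f.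
Proof.
elim: k f => [|k IH] f; first by case.
by case=> cf df; split=> // v; have [dv /IH] := df v.
Qed.

Lemma Ck_on_cst (W : normedModType R) k U (c : W) : Ck_on k U (fun _ : V => c).
Proof.
elim: k c => [|k IH] c; split=> //.
- by move=> x _; exact: cvg_cst.
- by move=> x _; exact: cvg_cst.
move=> v; split=> [x _|]; first exact: derivable_cst.
by rewrite (_ : 'D_v _ = fun=> 0) //; apply/funext => x; exact: derive_cst.
Qed.

Lemma Ck_onD k f g : Ck_on k setT f -> Ck_on k setT g -> Ck_on k setT (fun x => f x + g x).
Proof.
elim: k f g => [|k IH] f g [cf df] [cg dg]; split=> //.
- by move=> x Ux; apply: continuousD; [exact: cf | exact: cg].
- by move=> x Ux; apply: continuousD; [exact: cf | exact: cg].
move=> v; have [fv /IH fIH] := df v; have [gv /fIH gIH] := dg v.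
split=> [x Ux|]; first by apply: derivableD; [exact: fv | exact: gv].
suff -> : 'D_v (fun x => f x + g x) = (fun x => 'D_v f x + 'D_v g x) by [].
by apply/funext => x; apply: deriveD; [exact: fv | exact: gv].
Qed.

Lemma Ck_onM k f g : Ck_on k setT f -> Ck_on k setT g -> Ck_on k setT (fun x => f x * g x).
Proof.
elim: k f g => [|k IH] f g sf sg; split=> //.
- by move=> x Ux; apply: continuousM; [apply: sf.1 | apply: sg.1].
- by move=> x Ux; apply: continuousM; [apply: sf.1 | apply: sg.1].
move=> v; have [fv fIH] := sf.2 v; have [gv gIH] := sg.2 v.
split=> [x Ux|]; first by apply: derivableM; [exact: fv | exact: gv].
suff -> : 'D_v (fun x => f x * g x) = (fun x => f x * 'D_v g x + g x * 'D_v f x).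
  by apply: Ck_onD; apply: IH => //; exact: Ck_onW.
by apply/funext => x; apply: deriveM; [exact: fv | exact: gv].
Qed.

(** The derivative -(1/f)^2 D_v f involves 1/f again, one order lower; hence the induction on [k]
    with [f] fixed. *)
Lemma Ck_onV k f : (forall x, f x != 0) -> Ck_on k setT f -> Ck_on k setT (fun x => (f x)^-1).
Proof.
move=> f0; elim: k => [|k IH] sf; split=> //.
- by move=> x Ux; apply: continuousV; [apply: f0 | apply: sf.1].
- by move=> x Ux; apply: continuousV; [apply: f0 | apply: sf.1].
move=> v; have [fv fIH] := sf.2 v.
split=> [x Ux|]; first by apply: derivableV; [exact: f0 | exact: fv].
suff -> : 'D_v (fun x => (f x)^-1) = (fun x => ((-1) * ((f x)^-1 * (f x)^-1)) * 'D_v f x).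
  have sV := IH (Ck_onW sf).
  by apply: Ck_onM => //; apply: Ck_onM; [exact: Ck_on_cst | exact: Ck_onM].
apply/funext => x; rewrite [LHS]deriveV //; last exact: fv.
by rewrite mulN1r -expr2 exprVn.
Qed.

Lemma Ck_on_linear k f (df : V -> R) : continuous f ->
  (forall x v (h : R), f (h *: v + x) - f x = h * df v) -> Ck_on k setT f.
Proof.
move=> cf fE; case: k => [|k]; split=> //.
- by move=> x _; exact: cf.
- by move=> x _; exact: cf.
move=> v; have dv x : is_derive x v f (df v) by apply: is_derive_affine => h; exact: fE.
split=> [x _|]; first exact: ex_derive.
have -> : 'D_v f = fun=> df v by apply/funext => x; exact: derive_val.
exact: Ck_on_cst.
Qed.

Lemma csmooth_on_eq U (F G : V -> R[i]) : F =1 G -> csmooth_on U F -> csmooth_on U G.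
Proof. by move/funext => ->. Qed.

Lemma csmooth_on_cst U (c : R[i]) : csmooth_on U (fun=> c).
Proof. by split=> k; exact: Ck_on_cst. Qed.

Lemma csmooth_on_real (f : V -> R) U : smooth_on U f -> csmooth_on U (fun x => (f x)%:C).
Proof. by move=> sf; split=> // k; exact: Ck_on_cst. Qed.

Lemma csmooth_onD (F G : V -> R[i]) : csmooth_on setT F -> csmooth_on setT G ->
  csmooth_on setT (fun x => F x + G x).
Proof.
move=> [F1 F2] [G1 G2]; split=> k.
  rewrite (_ : (fun x => _) = fun x => complex.Re (F x) + complex.Re (G x)); first exact: Ck_onD.
  by apply/funext => x; case: (F x) (G x) => ? ? [].
rewrite (_ : (fun x => _) = fun x => complex.Im (F x) + complex.Im (G x)); first exact: Ck_onD.
by apply/funext => x; case: (F x) (G x) => ? ? [].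
Qed.

Lemma csmooth_onM (F G : V -> R[i]) : csmooth_on setT F -> csmooth_on setT G ->
  csmooth_on setT (fun x => F x * G x).
Proof.
move=> [F1 F2] [G1 G2]; split=> k.
  rewrite (_ : (fun x => _) = fun x => complex.Re (F x) * complex.Re (G x) +
      (-1) * (complex.Im (F x) * complex.Im (G x))).
    apply: Ck_onD; first exact: Ck_onM.
    by apply: Ck_onM; [exact: Ck_on_cst | exact: Ck_onM].
  by apply/funext => x; case: (F x) (G x) => ? ? [? ?] /=; rewrite mulN1r.
rewrite (_ : (fun x => _) = fun x => complex.Re (F x) * complex.Im (G x) +
    complex.Im (F x) * complex.Re (G x)).
  by apply: Ck_onD; exact: Ck_onM.
by apply/funext => x; case: (F x) (G x) => ? ? [? ?].
Qed.

Lemma csmooth_on_conj (F : V -> R[i]) : csmooth_on setT F -> csmooth_on setT (fun x => conjc (F x)).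
Proof.
move=> [F1 F2]; split=> k.
  rewrite (_ : (fun x => _) = fun x => complex.Re (F x)); first exact: F1.
  by apply/funext => x; case: (F x).
rewrite (_ : (fun x => _) = fun x => (-1) * complex.Im (F x)).
  by apply: Ck_onM; [exact: Ck_on_cst | exact: F2].
by apply/funext => x; case: (F x) => ? ? /=; rewrite mulN1r.
Qed.

Lemma csmooth_on_sum (I : Type) (r : seq I) (F : I -> V -> R[i]) :
  (forall i, csmooth_on setT (F i)) -> csmooth_on setT (fun x => \sum_(i <- r) F i x).
Proof.
move=> sF; elim: r => [|i r IH].
  by apply: (csmooth_on_eq (F := fun=> 0)) => [x|]; [rewrite big_nil | exact: csmooth_on_cst].
apply: (csmooth_on_eq (F := fun x => F i x + \sum_(j <- r) F j x)) => [x|].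
  by rewrite big_cons.
exact: csmooth_onD.
Qed.

End Smooth.

Section SmoothPlane.
Context {R : realType}.

Lemma csmooth_on_plane : csmooth_on setT (plane : R * R -> R[i]).
Proof.
split=> k.
  apply: (@Ck_on_linear R _ k _ (fun v => v.1)) => [|x v h /=]; last by rewrite addrK.
  by move=> p; exact: cvg_fst.
apply: (@Ck_on_linear R _ k _ (fun v => v.2)) => [|x v h /=]; last by rewrite addrK.
by move=> p; exact: cvg_snd.
Qed.

(** The factor 1 / (1 + |z|^2) normalises the explicit formula for the (1,0)-part of a real vector
    in either chart of P^1. *)
Lemma csmooth_on_planeV :
  csmooth_on setT (fun p : R * R => (1 + plane p * conjc (plane p))^-1).
Proof.
have e (p : R * R) : 1 + plane p * conjc (plane p) = (1 + (p.1 * p.1 + p.2 * p.2))%:C.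
  by apply/eqP; rewrite eq_complex /=; apply/andP; split; apply/eqP; ring.
apply: (csmooth_on_eq (F := fun p : R * R => ((1 + (p.1 * p.1 + p.2 * p.2))^-1)%:C)) => [p|].
  by rewrite e fmorphV.
apply: csmooth_on_real => k; have [c1 c2] := csmooth_on_plane; apply: Ck_onV => [p|].
  by rewrite gt_eqF // ltr_pwDl // addr_ge0 // -expr2 sqr_ge0.
apply: Ck_onD; first exact: Ck_on_cst.
by apply: Ck_onD; apply: Ck_onM; [exact: c1 | exact: c1 | exact: c2 | exact: c2].
Qed.

End SmoothPlane.

(** * Harmonic functions *)

Section Harmonic.
Context {R : realType}.
Local Notation e1 := ((1, 0) : R * R).
Local Notation e2 := ((0, 1) : R * R).

Definition harmonic (u : R * R -> R) := forall p,
  'D_e1 ('D_e1 u) p + 'D_e2 ('D_e2 u) p = 0.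

Definition vanishes_at_infinity (u : R * R -> R) :=
  forall e : R, 0 < e -> exists rho : R, forall p : R * R, rho <= `|p| -> `|u p| < e.

Lemma derive2_sqr_norm (h : R) (u : R * R -> R) (v : R * R) : Ck_on 2 setT u ->
  let f p := u p + h * (p.1 ^+ 2 + p.2 ^+ 2) in
  [/\ forall p, derivable f p v, forall p, derivable ('D_v f) p v &
      forall p, 'D_v ('D_v f) p = 'D_v ('D_v u) p + h * (2 * (v.1 ^+ 2 + v.2 ^+ 2))].
Proof.
case=> _ /(_ v) [du [_ /(_ v) [ddu _]]] f.
pose df p := 'D_v u p + h * (2 * (p.1 * v.1 + p.2 * v.2)).
have fst_v p : is_derive p v (fun q : R * R => q.1) v.1.
  by apply: is_derive_affine => t /=; rewrite addrK.
have snd_v p : is_derive p v (fun q : R * R => q.2) v.2.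
  by apply: is_derive_affine => t /=; rewrite addrK.
have fv p : is_derive p v f (df p).
  have u_v : is_derive p v u ('D_v u p) by apply: derivableP; exact: du.
  rewrite /f; apply: is_derive_eq; rewrite /df; congr (_ + _).
  by rewrite /GRing.scale /=; ring.
have ffv p : is_derive p v df ('D_v ('D_v u) p + h * (2 * (v.1 ^+ 2 + v.2 ^+ 2))).
  have u_v : is_derive p v ('D_v u) ('D_v ('D_v u) p) by apply: derivableP; exact: ddu.
  have l_v : is_derive p v (fun p : R * R => h * (2 * (p.1 * v.1 + p.2 * v.2)))
      (h * (2 * (v.1 ^+ 2 + v.2 ^+ 2))).
    apply: is_derive_affine => t; rewrite /GRing.scale /=.
    by rewrite -[t *: v.1]/(t * v.1) -[t *: v.2]/(t * v.2); ring.
  exact: is_deriveD.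
have Df : 'D_v f = df by apply/funext => p; exact: derive_val.
by split=> p; rewrite ?Df; [exact: ex_derive | exact: ex_derive | exact: derive_val].
Qed.

(* Weak maximum principle: adding a small multiple of |p|^2 makes the Laplacian
   positive, which rules out an interior maximum on a large square. *)
Lemma harmonic_le0 (u : R * R -> R) : Ck_on 2 setT u -> harmonic u ->
  vanishes_at_infinity u -> forall p, u p <= 0.
Proof.
move=> u2 hu u0 p0; rewrite leNgt; apply/negP => up0.
have [rho0 Hrho0] := u0 _ (divr_gt0 up0 (ltr0n _ 2)).
pose rho := Num.max (rho0) (`|p0| + 1).
have Hrho p : rho <= `|p| -> u p < u p0 / 2.
  by rewrite ge_max => /andP[/Hrho0/ltr_normlW].
have p0rho : `|p0| < rho by rewrite lt_max ltrDl ltr01 orbT.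
have rho_gt0 : 0 < rho by exact: le_lt_trans p0rho.
(* On the square |p|^2 is at most 2 rho^2, so the perturbation is at most u p0 / 4. On the boundary
   [f] is then below 3/4 u p0, while f p0 is at least u p0: the maximum is interior. *)
pose h := u p0 / 8 / rho ^+ 2.
have h0 : 0 < h by rewrite !divr_gt0 // exprn_gt0.
pose f p := u p + h * (p.1 ^+ 2 + p.2 ^+ 2).
pose K : set (R * R) := `[-rho, rho] `*` `[-rho, rho].
have KP p : K p <-> `|p| <= rho.
  by rewrite /K /= !in_itv /= prod_normE ge_max !ler_norml; split => [[-> ->]|/andP[-> ->]].
have f2 : Ck_on 2 setT f.
  apply: (Ck_onD u2); apply: Ck_onM; first exact: Ck_on_cst.
  under eq_fun do rewrite !expr2.
  have s1 := (@csmooth_on_plane R).1 2; have s2 := (@csmooth_on_plane R).2 2.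
  by apply: Ck_onD; [exact: (Ck_onM s1 s1) | exact: (Ck_onM s2 s2)].
have [|||p1 /set_mem Kp1 maxp1] := @compact_EVT_max _ R f K.
- by exists p0; apply/KP; exact: ltW.
- by apply: compact_setX; exact: segment_compact.
- by apply: continuous_subspaceT => p; exact: f2.1.
have fp01 : f p0 <= f p1 by apply: maxp1; apply/mem_set/KP; exact: ltW.
have p1rho : `|p1| < rho.
  rewrite ltNge; apply/negP => /Hrho up1.
  have sq (x : R) : `|x| <= rho -> x ^+ 2 <= rho ^+ 2.
    by move=> xr; rewrite -[x ^+ 2]ger0_norm ?sqr_ge0 // normrX lerXn2r // ?nnegrE // ltW.
  move/KP: Kp1; rewrite prod_normE ge_max => /andP[/sq s1 /sq s2].
  have : h * (p1.1 ^+ 2 + p1.2 ^+ 2) <= u p0 / 4.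
    apply: (@le_trans _ _ (h * (rho ^+ 2 + rho ^+ 2))); first by rewrite ler_pM2l // lerD.
    by rewrite -mulr2n -[rho ^+ 2 *+ 2]mulr_natr mulrA /h divfK ?expf_neq0 ?gt_eqF //; lra.
  have : 0 <= h * (p0.1 ^+ 2 + p0.2 ^+ 2) by rewrite mulr_ge0 ?addr_ge0 ?sqr_ge0 // ltW.
  by move: fp01 up1; rewrite /f; move: (u p0) (u p1) (h * _) (h * _) up0 => a b c d; lra.
have d2 v : 'D_v ('D_v f) p1 <= 0.
  have [fv ffv _] := derive2_sqr_norm h v u2.
  have cf : {for p1, continuous ('D_v ('D_v f))} by exact: ((f2.2 v).2.2 v).2.1.
  have d0 : 0 < rho - `|p1| by rewrite subr_gt0.
  apply: (derive2_local_max d0 fv ffv cf) => y yp1.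
  apply: maxp1; apply/mem_set/KP; rewrite -(subrK p1 y).
  rewrite (le_trans (ler_normD _ _)) // -lerBrDr; exact: ltW.
have [_ _ L1] := derive2_sqr_norm h e1 u2.
have [_ _ L2] := derive2_sqr_norm h e2 u2.
have := lerD (d2 e1) (d2 e2); rewrite addr0 L1 L2 /= addrACA hu add0r !expr0n !expr1n /=.
by move: (h) h0 => k; lra.
Qed.

Lemma Ck_onZ k (c : R) (u : R * R -> R) : Ck_on k setT u -> Ck_on k setT (fun p => c * u p).
Proof. by move=> su; apply: Ck_onM => //; exact: Ck_on_cst. Qed.

Lemma harmonic_eq0 (u : R * R -> R) : Ck_on 2 setT u -> harmonic u ->
  vanishes_at_infinity u -> forall p, u p = 0.
Proof.
move=> u2 hu u0 p; apply/eqP; rewrite eq_le harmonic_le0 //=.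
have N (v : R * R) (f : R * R -> R) : (forall p, derivable f p v) ->
    'D_v (fun p => -1 * f p) = fun p => -1 * 'D_v f p.
  by move=> df; apply/funext => q; exact: (@deriveZ _ _ _ f (-1) q v (df q)).
suff : -1 * u p <= 0 by rewrite mulN1r oppr_le0.
apply: (@harmonic_le0 (fun p => -1 * u p)).
- exact: Ck_onZ.
- have NN v q : 'D_v ('D_v (fun p => -1 * u p)) q = -1 * 'D_v ('D_v u) q.
    have d1 y : derivable u y v by exact: (u2.2 v).1.
    have d2 y : derivable ('D_v u) y v by exact: ((u2.2 v).2.2 v).1.
    by rewrite (N v u d1) -(congr1 (fun f => f q) (N v _ d2)).
  by move=> q; rewrite (NN e1) (NN e2) -mulrDr [X in _ * X](hu q) mulr0.
- by move=> e /u0 [rho Hrho]; exists rho => q /Hrho; rewrite mulN1r normrN.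
Qed.

(* By Schwarz' theorem the Cauchy-Riemann equations make both parts harmonic. *)
Lemma cauchy_riemann_eq0 (u v : R * R -> R) : Ck_on 2 setT u -> Ck_on 2 setT v ->
  (forall p, 'D_e1 u p = 'D_e2 v p) -> (forall p, 'D_e2 u p = - 'D_e1 v p) ->
  vanishes_at_infinity u -> forall p, u p = 0.
Proof.
move=> u2 v2 ux uy; apply: harmonic_eq0 => // p.
have d (f : R * R -> R) w w' (f2 : Ck_on 2 setT f) : [/\ forall y, derivable f y w,
    forall y, derivable ('D_w f) y w' & {for p, continuous ('D_w' ('D_w f))}].
  by split=> [y|y|]; [exact: (f2.2 w).1 | exact: ((f2.2 w).2.2 w').1 | exact: ((f2.2 w).2.2 w').2.1].
rewrite (_ : 'D_e1 u = 'D_e2 v); last exact/funext.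
rewrite (_ : 'D_e2 u = - 'D_e1 v); last exact/funext.
have [a1 a2 a3] := d v e1 e2 v2; have [b1 b2 b3] := d v e2 e1 v2.
by rewrite (deriveN (a2 p)) (derive_comm a1 a2 b1 b2 a3 b3) subrr.
Qed.

End Harmonic.

(** * Entire functions *)

Section ComplexDerivative.
Context {R : realType}.
Local Notation C := R[i].

Lemma realC_norm (x : R) : `|x%:C| = `|x|%:C.
Proof. by rewrite normc_def /= expr0n /= addr0 sqrtr_sqr. Qed.

Lemma Re_le_norm (z : C) : `|complex.Re z|%:C <= `|z|.
Proof.
case: z => a b; rewrite normc_def lecR /= -sqrtr_sqr ler_wsqrtr //.
by rewrite lerDl sqr_ge0.
Qed.

Lemma Im_le_norm (z : C) : `|complex.Im z|%:C <= `|z|.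
Proof.
case: z => a b; rewrite normc_def lecR /= -sqrtr_sqr ler_wsqrtr //.
by rewrite lerDr sqr_ge0.
Qed.

Lemma gt0_realC (z : C) : 0 < z -> z = (complex.Re z)%:C.
Proof. by case: z => a b; rewrite ltcE /= => /andP[/eqP -> _]. Qed.

(** A complex limit is restricted to the real line through [th], and [l] is the real or imaginary
    part. The factor [th] turns a quotient by t th into a quotient by t. *)
Lemma real_linear_cvg (l : C -> R) (q : C^o -> C^o) (c th : C) :
  (forall x y, l (x - y) = l x - l y) -> (forall x, `|l x|%:C <= `|x|) -> th != 0 ->
  q @ (0 : C^o)^' --> (c : C^o) ->
  l (th * q (t%:C * th)) @[t --> (0 : R)^'] --> l (th * c).
Proof.
move=> lB ln th0 qc; apply/cvgrPdist_le => e e0.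
have nth0 : 0 < `|th| by rewrite normr_gt0.
have e0C : 0 < e%:C / `|th| by rewrite divr_gt0 // ltcR.
move/cvgrPdist_le : qc => /(_ _ e0C); rewrite !near_withinE => /nbhs_ballP[d /= d0 Hd].
have dE := gt0_realC d0.
have d0' : 0 < complex.Re d by rewrite -ltcR -dE.
pose m := complex.Re `|th|.
have mE : `|th| = m%:C := gt0_realC nth0.
have m0 : 0 < m by rewrite -ltcR -mE.
apply/nbhs_ballP; exists (complex.Re d / m) => [|t]; first exact: divr_gt0.
rewrite -ball_normE /= sub0r normrN => td t0.
have := Hd (t%:C * th); rewrite -ball_normE /= sub0r normrN normrM mE realC_norm.
have tdC : `|t|%:C * m%:C < d by rewrite dE -rmorphM ltcR -ltr_pdivlMr.
have tth0 : t%:C * th != 0 by rewrite mulf_neq0 // fmorph_eq0.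
move=> /(_ tdC tth0); rewrite -mE ler_pdivlMr // mulrC -normrM mulrBr => H.
by rewrite -lB -lecR (le_trans (ln _)).
Qed.

(** The real derivative along [v] is the complex derivative multiplied by [v]; the directions 1 and
    i give the Cauchy-Riemann equations. *)
Lemma is_derive_plane (F : C -> C) (p v : R * R) (c : C) : plane v != 0 ->
  is_derive (plane p : C^o) 1 (F : C^o -> C^o) c ->
  is_derive p v (fun q => complex.Re (F (plane q))) (complex.Re (plane v * c)) /\
  is_derive p v (fun q => complex.Im (F (plane q))) (complex.Im (plane v * c)).
Proof.
move=> v0 [dF dFc].
have dc : (fun h : C^o => h^-1 *: (((F : C^o -> C^o) \o shift (plane p : C^o)) (h *: (1 : C^o))
    - F (plane p))) @ (0 : C^o)^' --> (c : C^o) by rewrite -dFc.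
have lin (l : C -> R) : (forall x y, l (x - y) = l x - l y) ->
    (forall x (t : R), l (t%:C * x) = t * l x) ->
    (forall x, `|l x|%:C <= `|x|) ->
    is_derive p v (fun q => l (F (plane q))) (l (plane v * c)).
  move=> lB lZ ln; have := real_linear_cvg lB ln v0 dc =>  dl.
  have eq_quot : {near (0 : R)^', (fun t : R => l (plane v * ((t%:C * plane v)^-1 *:
     ((F \o shift (plane p)) ((t%:C * plane v) *: (1 : C^o)) - F (plane p))))) =1
     (fun t : R => t^-1 *: (((fun q => l (F (plane q))) \o shift p) (t *: v) - l (F (plane p))))}.
    rewrite near_withinE; apply: nearW => t t0 /=.
    rewrite -[_ *: 1]/(_ * 1) mulr1 -[_ *: (F _ - _)]/(_ * _) invfM [_^-1 * _^-1]mulrC !mulrA.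
    rewrite divff // mul1r -fmorphV lZ lB; congr (_ * (l (F _) - _)).
    by apply/eqP; rewrite eq_complex /= !mul0r subr0 addr0 !eqxx.
  have dl' : (fun t : R => t^-1 *: (((fun q => l (F (plane q))) \o shift p) (t *: v)
      - l (F (plane p)))) @ 0^' --> l (plane v * c).
    by apply: cvg_trans dl; apply: near_eq_cvg; exact: eq_quot.
  by split; [apply/cvg_ex; eexists; exact: dl' | apply: cvg_lim dl'; exact: norm_hausdorff].
split; apply: lin.
- by move=> [? ?] [? ?].
- by move=> [? ?] t /=; rewrite mul0r subr0.
- exact: Re_le_norm.
- by move=> [? ?] [? ?].
- by move=> [? ?] t /=; rewrite mul0r addr0.
- exact: Im_le_norm.
Qed.

(** The imaginary part is handled as the real part of -i h: the pair (u, v) is replaced by (v, -u),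
    which again satisfies the Cauchy-Riemann equations. *)
Lemma entire_eq0 (h : C -> C) : csmooth_on setT (fun p : R * R => h (plane p)) ->
  (forall z : C^o, derivable (h : C^o -> C^o) z 1) ->
  (forall e : C, 0 < e -> exists rho : R, forall p : R * R, rho <= `|p| -> `|h (plane p)| < e) ->
  forall z, h z = 0.
Proof.
move=> [sr si] dh h0 z.
pose u p := complex.Re (h (plane p)); pose v p := complex.Im (h (plane p)).
pose D (p : R * R) : C := 'D_(1 : C^o) (h : C^o -> C^o) (plane p : C^o).
have [d1 d2] : (forall p : R * R,
     is_derive p ((1, 0) : R * R) u (complex.Re (D p)) /\
     is_derive p ((1, 0) : R * R) v (complex.Im (D p))) /\
   (forall p : R * R,
     is_derive p ((0, 1) : R * R) u (- complex.Im (D p)) /\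
     is_derive p ((0, 1) : R * R) v (complex.Re (D p))).
  split=> p; have dp := derivableP (dh (plane p)); rewrite -/(D p) in dp.
    have n0 : plane (1, 0) != 0 :> C by rewrite eq_complex /= oner_eq0.
    have := is_derive_plane n0 dp; rewrite [plane _ * _]mul1r; exact.
  have n0 : plane (0, 1) != 0 :> C by rewrite eq_complex /= oner_eq0 andbF.
  have := is_derive_plane n0 dp; case: (D p) => a b.
  by rewrite /= !mul0r !mul1r !add0r.
have small (l : C -> R) : (forall x, `|l x|%:C <= `|x|) ->
    vanishes_at_infinity (fun p => l (h (plane p))).
  move=> ln e e0; have e0C : 0 < e%:C :> C by rewrite ltcR.
  have [rho Hrho] := h0 _ e0C; exists rho => p /Hrho.
  by move/(le_lt_trans (ln _)); rewrite ltcR.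
have Du p : 'D_((1, 0) : R * R) u p = 'D_((0, 1) : R * R) v p.
  by rewrite (@derive_val _ _ _ _ _ _ _ (d1 p).1) (@derive_val _ _ _ _ _ _ _ (d2 p).2).
have Dv p : 'D_((0, 1) : R * R) u p = - 'D_((1, 0) : R * R) v p.
  by rewrite (@derive_val _ _ _ _ _ _ _ (d1 p).2) (@derive_val _ _ _ _ _ _ _ (d2 p).1).
have u0 := cauchy_riemann_eq0 (sr 2) (si 2) Du Dv (small _ Re_le_norm).
have mu2 : Ck_on 2 setT (fun p => -1 * u p) by apply: Ck_onM; [exact: Ck_on_cst | exact: sr].
have Du' p : 'D_((1, 0) : R * R) v p = 'D_((0, 1) : R * R) (fun p => -1 * u p) p.
  by rewrite [RHS](deriveZ _ (@ex_derive _ _ _ _ _ _ _ (d2 p).1)) Dv scaleN1r opprK.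
have Dv' p : 'D_((0, 1) : R * R) v p = - 'D_((1, 0) : R * R) (fun p => -1 * u p) p.
  by rewrite [X in - X](deriveZ _ (@ex_derive _ _ _ _ _ _ _ (d1 p).1)) Du scaleN1r opprK.
have v0 := cauchy_riemann_eq0 (si 2) mu2 Du' Dv' (small _ Im_le_norm).
have := u0 (complex.Re z, complex.Im z); have := v0 (complex.Re z, complex.Im z).
rewrite /u /v /plane /=; case: z => a b /=; case: (h _) => x y /= -> ->.
by apply/eqP; rewrite eq_complex /= !eqxx.
Qed.

End ComplexDerivative.

(** * Entire functions that are regular at infinity after a twist by O(1) *)

Section AffineEntire.
Context {R : realType}.
Local Notation C := R[i].

(* f(z) - z g(0) - g'(0) is entire and vanishes at infinity. *)
Lemma entire_affine (f g : C -> C) : csmooth_on setT (fun p : R * R => f (plane p)) ->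
  (forall z : C^o, derivable (f : C^o -> C^o) z 1) ->
  derivable (g : C^o -> C^o) (0 : C^o) 1 ->
  (forall w, w != 0 -> g w = w * f w^-1) ->
  forall z, f z = f 0 + z * g 0.
Proof.
move=> sf df dg gE; pose g' : C := 'D_(1 : C^o) (g : C^o -> C^o) (0 : C^o).
pose l (z : C^o) : C^o := - g' - z * g 0.
have dl (z : C^o) : is_derive z (1 : C^o) l (- g 0).
  apply: is_derive_affine => k; rewrite /l /GRing.scale /=; ring.
have h0 : forall z, f z + l z = 0.
  apply: entire_eq0.
  - apply: csmooth_onD => //.
    rewrite (_ : (fun p => _) = fun p => - g' + plane p * (- g 0)); last first.
      by apply/funext => p; rewrite /l mulrN.
    apply: csmooth_onD; first exact: csmooth_on_cst.
    by apply: csmooth_onM; [exact: csmooth_on_plane | exact: csmooth_on_cst].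
  - by move=> z; apply: (derivableD (df z)); exact: (@ex_derive _ _ _ _ _ _ _ (dl z)).
  move=> e e0; have dc : (fun h : C^o => h^-1 *:
      (((g : C^o -> C^o) \o shift (0 : C^o)) (h *: (1 : C^o)) - g 0)) @ (0 : C^o)^'
      --> (g' : C^o) by [].
  move/cvgrPdist_lt : dc => /(_ _ e0); rewrite !near_withinE => /nbhs_ballP[d /= d0 Hd].
  have dE := gt0_realC d0.
  have d0' : 0 < complex.Re d by rewrite -ltcR -dE.
  (* Beyond this radius 1/z lies in the ball of radius [d], where the difference quotient of [g] at
     0 is close to g'(0). At w = 1/z that quotient is f z - z g 0. *)
  exists ((complex.Re d)^-1 + 1) => p rp; set z := plane p.
  have zn : (complex.Re d)^-1%:C < `|z|.
    apply: (@lt_le_trans _ _ (`|p|%:C)); first by rewrite ltcR (lt_le_trans _ rp) // ltrDl.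
    by rewrite prod_normE; case: leP => _; [exact: (Im_le_norm z) | exact: (Re_le_norm z)].
  have z0 : z != 0.
    by rewrite -normr_gt0 (le_lt_trans _ zn) // lecR invr_ge0 ltW.
  have := Hd z^-1; rewrite -ball_normE /= sub0r normrN normrV ?unitfE // => /(_ _ _)/wrap[].
    have nz : 0 < `|z| by rewrite normr_gt0.
    have dC : 0 < (complex.Re d)%:C :> C by rewrite ltcR.
    by rewrite dE invf_plt // -fmorphV.
    exact: invr_neq0.
  rewrite addr0 -[_ *: 1]/(_ * 1) mulr1 gE ?invr_neq0 // !invrK.
  rewrite -[z *: _]/(z * _) mulrBr mulrA divff // mul1r distrC.
  by rewrite /l addrA addrAC.
have f0 z : f z = g' + z * g 0.
  by apply: subr0_eq; rewrite -[RHS](h0 z) /l opprD.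
by move=> z; rewrite !f0 mul0r addr0.
Qed.

End AffineEntire.

(** * Split forms *)

Section SplitForms.
Context {R : realType} {n : nat}.
Local Notation C := R[i].
Implicit Types (B X Y : 'M[C]_n).

Lemma conjMD m k (X Y : 'M[C]_(m, k)) : conjM (X + Y) = conjM X + conjM Y.
Proof. exact: map_mxD. Qed.
Lemma conjMN m k (X : 'M[C]_(m, k)) : conjM (- X) = - conjM X.
Proof. exact: map_mxN. Qed.
Lemma conjMB m k (X Y : 'M[C]_(m, k)) : conjM (X - Y) = conjM X - conjM Y.
Proof. by rewrite conjMD conjMN. Qed.
Lemma conjM0 m k : conjM (0 : 'M[C]_(m, k)) = 0.
Proof. exact: map_mx0. Qed.
Lemma conjMT m k (X : 'M[C]_(m, k)) : conjM X^T = (conjM X)^T.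
Proof. by apply/matrixP => i j; rewrite !mxE. Qed.
Lemma conjM_toC m k (X : 'M[R]_(m, k)) : conjM (toC X) = toC X.
Proof. by apply/matrixP => i j; rewrite !mxE /= oppr0. Qed.
Lemma toCM m k l (X : 'M[R]_(m, k)) (Y : 'M[R]_(k, l)) : toC (X *m Y) = toC X *m toC Y.
Proof. exact: map_mxM. Qed.
Lemma conji : conjc 'i%C = - 'i%C :> C.
Proof. by apply/eqP; rewrite eq_complex /= oppr0 !eqxx. Qed.
Lemma iM : 'i%C * 'i%C = -1 :> C.
Proof. by apply/eqP; rewrite eq_complex /= !mul0r !mul1r sub0r addr0 oppr0 !eqxx. Qed.
Lemma i_neq0 : 'i%C != 0 :> C.
Proof. by rewrite eq_complex /= oner_eq0 andbF. Qed.

Lemma sub_iP m (u : 'M[C]_(m, n)) (A : 'M[C]_n) : u *m A = 0 <-> (u <= kermx A)%MS.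
Proof. exact: (rwP sub_kermxP). Qed.

Lemma splits_conj (B : 'M[C]_n) : splits B -> splits (conjM B).
Proof.
have swap (X Y : 'M[C]_n) : row_full (X + Y)%MS && ((X :&: Y)%MS == 0) ->
  row_full (Y + X)%MS && ((Y :&: X)%MS == 0) by rewrite addsmxC capmxC.
by rewrite /splits /T01 /T10 conjMK; exact: swap.
Qed.

(* K, L, P, Q, J stand for T10 B, T01 B, pr10 B, pr01 B and the complex structure of
   B.  They are kept abstract because unification would compare the concrete kernels
   by computation. *)
Record split_system (B K L P Q J : 'M[C]_n) : Prop := SplitSystem {
  split_antisym : B^T = - B ;
  split_K : forall m (u : 'M[C]_(m, n)), u *m conjM B = 0 <-> (u <= K)%MS ;
  split_L : forall m (u : 'M[C]_(m, n)), u *m B = 0 <-> (u <= L)%MS ;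
  split_full : row_full (L + K)%MS ;
  split_cap : (L :&: K = 0)%MS ;
  split_conj : conjM K = L ;
  split_PK : forall m (u : 'M[C]_(m, n)), (u *m P <= K)%MS ;
  split_QL : forall m (u : 'M[C]_(m, n)), (u *m Q <= L)%MS ;
  split_P : forall m (u : 'M[C]_(m, n)), (u <= K)%MS -> u *m P = u ;
  split_Q : forall m (u : 'M[C]_(m, n)), (u <= L)%MS -> u *m Q = u ;
  split_LP : forall m (u : 'M[C]_(m, n)), (u <= L)%MS -> u *m P = 0 ;
  split_KQ : forall m (u : 'M[C]_(m, n)), (u <= K)%MS -> u *m Q = 0 ;
  split_KJ : K *m J = 'i%C *: K ;
  split_LJ : L *m J = - 'i%C *: L ;
}.

Lemma split_systemP B : B^T = - B -> splits B ->
  split_system B (T10 B) (T01 B) (pr10 B) (pr01 B) (toC (cplx_structure B)).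
Proof.
move=> aB sB; have /andP[full /eqP cap] := sB.
have cap' : (T10 B :&: T01 B = 0)%MS by rewrite capmxC.
have [JK JL] := (cplx_structureP (cplx_structure B) sB).1 erefl.
have cK : conjM (T10 B) = T01 B by rewrite /T10 conj_kermx conjMK.
split.
- exact: aB.
- by move=> m u; exact: sub_iP.
- by move=> m u; exact: sub_iP.
- exact: full.
- exact: cap.
- exact: cK.
- by move=> m u; exact: proj_mx_sub.
- by move=> m u; exact: proj_mx_sub.
- by move=> m u; exact: proj_mx_id cap'.
- by move=> m u; exact: proj_mx_id cap.
- by move=> m u; exact: proj_mx_0 cap'.
- by move=> m u; exact: proj_mx_0 cap.
- exact: JK.
- exact: JL.
Qed.

Section SplitSystem.
Context {B K L P Q J : 'M[C]_n} (sS : split_system B K L P Q J).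

Lemma split_ext (X Y : 'M[C]_n) : L *m X = L *m Y -> K *m X = K *m Y -> X = Y.
Proof. exact: row_full_eq (split_full sS). Qed.

Lemma split_KP : K *m P = K. Proof. exact: (split_P sS). Qed.
Lemma split_LQ : L *m Q = L. Proof. exact: (split_Q sS). Qed.
Lemma split_LP0 : L *m P = 0. Proof. exact: (split_LP sS). Qed.
Lemma split_KQ0 : K *m Q = 0. Proof. exact: (split_KQ sS). Qed.

Lemma split_sum : P + Q = 1%:M.
Proof.
apply: split_ext; first by rewrite mulmxDr split_LP0 split_LQ add0r mulmx1.
by rewrite mulmxDr split_KP split_KQ0 addr0 mulmx1.
Qed.

Lemma split_decomp m (u : 'M[C]_(m, n)) : u = u *m P + u *m Q.
Proof. by rewrite -mulmxDr split_sum mulmx1. Qed.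

Lemma split_disjoint m (u : 'M[C]_(m, n)) : (u <= K)%MS -> (u <= L)%MS -> u = 0.
Proof. by move=> uK uL; rewrite -(split_P sS uK) (split_LP sS uL). Qed.

Lemma conj_L : conjM L = K.
Proof. by rewrite -(split_conj sS) conjMK. Qed.

Lemma conj_sub_K m (u : 'M[C]_(m, n)) : (conjM u <= K)%MS <-> (u <= L)%MS.
Proof.
rewrite -(split_K sS) -(split_L sS) -conjMM; split; last by move=> ->; exact: conjM0.
by move/(congr1 (@conjM R _ _)); rewrite conjMK conjM0.
Qed.

Lemma conj_sub_L m (u : 'M[C]_(m, n)) : (conjM u <= L)%MS <-> (u <= K)%MS.
Proof. by rewrite -conj_sub_K conjMK. Qed.

Lemma conj_P : conjM P = Q.
Proof.
apply: split_ext; first by rewrite split_LQ -(split_conj sS) -conjMM split_KP.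
by rewrite split_KQ0 -conj_L -conjMM split_LP0 conjM0.
Qed.

(** Conjugation exchanges the complementary spaces [K] and [L], so they have equal rank. *)
Lemma rank_K : (\rank K).*2 = n.
Proof.
have /eqP e := split_full sS; rewrite -[RHS]e.
have := mxrank_sum_cap L K; rewrite (split_cap sS) mxrank0 addn0 => ->.
by rewrite -(split_conj sS) mxrank_map addnn.
Qed.

Lemma split_J_K m (u : 'M[C]_(m, n)) : (u <= K)%MS -> u *m J = 'i%C *: u.
Proof. by case/submxP => v ->; rewrite -mulmxA (split_KJ sS) -scalemxAr. Qed.

Lemma split_J_L m (u : 'M[C]_(m, n)) : (u <= L)%MS -> u *m J = - 'i%C *: u.
Proof. by case/submxP => v ->; rewrite -mulmxA (split_LJ sS) -scalemxAr. Qed.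

Lemma split_JP : J *m P = 'i%C *: P.
Proof.
apply: split_ext; rewrite mulmxA -scalemxAr.
  by rewrite (split_LJ sS) -scalemxAl split_LP0 !scaler0.
by rewrite (split_KJ sS) -scalemxAl.
Qed.

Lemma split_J_sqr : J *m J = - 1%:M.
Proof.
apply: split_ext; rewrite mulmxA mulmxN mulmx1.
  by rewrite (split_LJ sS) -scalemxAl (split_LJ sS) scalerA mulrNN iM scaleN1r.
by rewrite (split_KJ sS) -scalemxAl (split_KJ sS) scalerA iM scaleN1r.
Qed.

Lemma split_L_mul m (u : 'M[C]_(m, n)) : (u <= L)%MS -> u *m B = 0.
Proof. by move/(split_L sS). Qed.

Lemma split_K_mul m (u : 'M[C]_(m, n)) : (u <= K)%MS -> u *m conjM B = 0.
Proof. by move/(split_K sS). Qed.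

Lemma split_P_form : P *m B = B.
Proof.
rewrite -[RHS]mul1mx -split_sum mulmxDl -[X in _ + X *m _]mul1mx.
by rewrite (split_L_mul (split_QL sS _)) addr0.
Qed.

Lemma split_form_P : B *m P^T = B.
Proof.
apply: trmx_inj; rewrite trmx_mul trmxK (split_antisym sS) mulmxN.
by rewrite split_P_form.
Qed.

Lemma split_conj_form_P : conjM B *m P^T = 0.
Proof.
apply: trmx_inj; rewrite trmx_mul trmxK trmx0 -conjMT (split_antisym sS) conjMN mulmxN.
by rewrite -[X in X *m _]mul1mx (split_K_mul (split_PK sS _)) oppr0.
Qed.

(** The form has type (2,0): it kills [L] on the left and, being antisymmetric, on the right.
    Evaluating sections at zeta therefore loses nothing of the form on real vectors. *)
Lemma bil_P (u w : 'rV[C]_n) : bil B (u *m P) (w *m P) = bil B u w.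
Proof.
rewrite /bil trmx_mul mulmxA -[u *m P *m B]mulmxA split_P_form.
by rewrite -[u *m B *m P^T]mulmxA split_form_P.
Qed.

(** The two terms have types (2,0) and (0,2). Right multiplication by [P^T] keeps the first and
    kills the second, so a vector in the kernel is killed by both and lies in the intersection of
    [K] and [L]. *)
Lemma lin_comb_unit (a b : C) : a != 0 -> b != 0 -> a *: B + b *: conjM B \in unitmx.
Proof.
move=> a0 b0; rewrite -row_free_unit -kermx_eq0; apply/eqP.
set A := (_ + _); set u := kermx A; have uA : u *m A = 0 by exact: mulmx_ker.
clearbody u.
have uB0 : u *m B = 0.
  have : u *m A *m P^T = 0 by rewrite uA mul0mx.
  rewrite /A -mulmxA mulmxDl -!scalemxAl split_form_P split_conj_form_P scaler0 addr0.
  by rewrite -scalemxAr => /eqP; rewrite scaler_eq0 (negPf a0) => /eqP.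
have ucB0 : u *m conjM B = 0.
  move: uA; rewrite mulmxDr -!scalemxAr uB0 scaler0 add0r => /eqP.
  by rewrite scaler_eq0 (negPf b0) => /eqP.
by apply: split_disjoint; [apply/(split_K sS) | apply/(split_L sS)].
Qed.

(** [X] and [Y] are proportional to B + conj B and B - conj B, hence invertible. As B vanishes on
    [L] and conj B on [K], X is -i Y on [L] and i Y on [K]. *)
Lemma split_JE X Y : B = X + 'i%C *: Y -> conjM X = X -> conjM Y = Y ->
  [/\ X \in unitmx, Y \in unitmx & J = X *m invmx Y].
Proof.
move=> BE cX cY.
have cBE : conjM B = X - 'i%C *: Y by rewrite BE conjMD conjMZ cX cY conji scaleNr.
have uX : X \in unitmx.
  have := lin_comb_unit (oner_neq0 _) (oner_neq0 _).
  rewrite !scale1r cBE BE addrACA subrr addr0 -mulr2n -scaler_nat unitmxZ //.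
  by rewrite unitfE pnatr_eq0.
have uY : Y \in unitmx.
  have N1 : -1 != 0 :> C by rewrite oppr_eq0 oner_eq0.
  have := lin_comb_unit (oner_neq0 _) N1.
  rewrite scale1r scaleN1r cBE BE opprB addrC addrA subrK -scalerDl unitmxZ //.
  by rewrite unitfE -mulr2n -mulr_natl mulf_neq0 ?pnatr_eq0 ?i_neq0.
split=> //; apply: split_ext.
  rewrite (split_LJ sS) mulmxA; have : L *m B = 0 by exact: split_L_mul.
  rewrite BE mulmxDr -scalemxAr => /eqP; rewrite addr_eq0 => /eqP ->.
  by rewrite mulNmx -scalemxAl mulmxK // scaleNr.
rewrite (split_KJ sS) mulmxA; have : K *m conjM B = 0 by exact: split_K_mul.
rewrite cBE mulmxBr -scalemxAr => /eqP; rewrite subr_eq0 => /eqP ->.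
by rewrite -scalemxAl mulmxK.
Qed.

End SplitSystem.
End SplitForms.

(** * The quaternionic structure at a point *)

Section QuaternionicPoint.
Context {R : realType} {n : nat}.
Local Notation C := R[i].
Context {Wp W3 : 'M[C]_n} {K L P Q : P1 (R := R) -> 'M[C]_n} {Jr : P1 (R := R) -> 'M[R]_n}.
Local Notation B := (pencil Wp W3 (conjM Wp)).
Context (W3_real : conjM W3 = W3).
Context (sys : forall zeta,
  split_system (B zeta) (K zeta) (L zeta) (P zeta) (Q zeta) (toC (Jr zeta))).
Local Notation W1 := (2^-1 *: (Wp + conjM Wp)).
Local Notation W2 := ((2 * 'i%C)^-1 *: (Wp - conjM Wp)).
Local Notation I1 := (toC (Jr (aff 'i%C))).
Local Notation I2 := (toC (Jr (aff (-1)))).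
Local Notation I3 := (toC (Jr (aff 0))).
Local Notation K0 := (K (aff 0)).
Local Notation L0 := (L (aff 0)).
Local Notation P0 := (P (aff 0)).

Lemma two_neq0 : 2 != 0 :> C. Proof. by rewrite pnatr_eq0. Qed.
Lemma conjcV (z : C) : conjc z^-1 = (conjc z)^-1.
Proof. exact: fmorphV. Qed.
Lemma conjcM (z w : C) : conjc (z * w) = conjc z * conjc w.
Proof. exact: rmorphM. Qed.
Lemma conjcN (z : C) : conjc (- z) = - conjc z.
Proof. exact: rmorphN. Qed.
Lemma conjc2 : conjc 2 = 2 :> C.
Proof. exact: rmorph_nat. Qed.

Lemma conjc_0 : conjc 0 = 0 :> C.
Proof. exact: rmorph0. Qed.

Lemma pencil0 : B (aff 0) = Wp.
Proof. by rewrite /aff /= eqxx. Qed.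

Lemma pencil_neq0 z : z != 0 ->
  B (aff z) = (- ('i%C / (2 * z))) *: Wp + W3 - (('i%C * z) / 2) *: conjM Wp.
Proof. by move=> z0; rewrite /aff /= (negPf z0). Qed.

Lemma W1_real : conjM W1 = W1.
Proof. by rewrite conjMZ conjMD conjMK conjcV conjc2 addrC. Qed.

Lemma W2_real : conjM W2 = W2.
Proof.
rewrite conjMZ conjMB conjMK conjcV conjcM conjc2 conji mulrN invrN scaleNr -scalerN opprB.
by [].
Qed.

Lemma Wp_E : Wp = W1 + 'i%C *: W2.
Proof.
rewrite scalerA invfM mulrCA divff ?i_neq0 // mulr1 -scalerDr addrACA subrr addr0.
by rewrite -[Wp + Wp]mulr2n -[Wp *+ 2]scaler_nat scalerA mulVf ?two_neq0 // scale1r.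
Qed.

Lemma pencil_N1 : B (aff (-1)) = W3 + 'i%C *: W1.
Proof.
rewrite pencil_neq0 ?oppr_eq0 ?oner_eq0 // !mulrN1 invrN mulrN opprK mulNr scaleNr opprK.
by rewrite scalerA scalerDr addrAC addrC.
Qed.

Lemma pencil_i : B (aff 'i%C) = W3 + 'i%C *: (- W2).
Proof.
rewrite pencil_neq0 ?i_neq0 // iM mulN1r !scaleNr opprK scalerN scalerA invfM mulrCA.
rewrite divff ?i_neq0 // mulr1 scalerBr opprB [- _ + W3]addrC -addrA; congr (_ + _).
by rewrite addrC.
Qed.

Lemma Wp_antisym : Wp^T = - Wp.
Proof. by have := split_antisym (sys (aff 0)); rewrite pencil0. Qed.
Lemma Wm_antisym : (conjM Wp)^T = - conjM Wp.
Proof. by rewrite -conjMT Wp_antisym conjMN. Qed.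
Lemma W1_antisym : W1^T = - W1.
Proof. by rewrite linearZ linearD /= Wp_antisym Wm_antisym -opprD scalerN. Qed.
Lemma W2_antisym : W2^T = - W2.
Proof. by rewrite linearZ linearB /= Wp_antisym Wm_antisym -opprD scalerN. Qed.
Lemma W3_antisym : W3^T = - W3.
Proof.
have := split_antisym (sys (aff (-1))); rewrite pencil_N1 linearD linearZ /= W1_antisym.
by rewrite scalerN opprD => /addIr.
Qed.

Lemma I_sqr zeta : toC (Jr zeta) *m toC (Jr zeta) = - 1%:M.
Proof. exact: split_J_sqr (sys zeta). Qed.

Lemma I_sqr_mul zeta m (A : 'M[C]_(n, m)) : toC (Jr zeta) *m (toC (Jr zeta) *m A) = - A.
Proof. by rewrite mulmxA I_sqr mulNmx mul1mx. Qed.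

Lemma mul_I_sqr zeta m (A : 'M[C]_(m, n)) : A *m toC (Jr zeta) *m toC (Jr zeta) = - A.
Proof. by rewrite -mulmxA I_sqr mulmxN mulmx1. Qed.

Lemma W_I : [/\ W1 \in unitmx, W2 \in unitmx, W3 \in unitmx &
  [/\ I1 *m W2 = - W3, I2 *m W1 = W3 & I3 *m W2 = W1]].
Proof.
have [u1 u2 e3] := split_JE (sys (aff 0)) (etrans pencil0 Wp_E) W1_real W2_real.
have [u3 _ e2] := split_JE (sys (aff (-1))) pencil_N1 W3_real W1_real.
have cW2 : conjM (- W2) = - W2 by rewrite conjMN W2_real.
have [_ u2' e1] := split_JE (sys (aff 'i%C)) pencil_i W3_real cW2.
split; [exact: u1 | exact: u2 | exact: u3 | split].
- by rewrite e1 -[X in _ *m X]opprK mulmxN (mulmxKV u2').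
- by rewrite e2 (mulmxKV u1).
- by rewrite e3 (mulmxKV u2).
Qed.

Lemma I1W2 : I1 *m W2 = - W3. Proof. by case: W_I => _ _ _ []. Qed.
Lemma I2W1 : I2 *m W1 = W3. Proof. by case: W_I => _ _ _ []. Qed.
Lemma I3W2 : I3 *m W2 = W1. Proof. by case: W_I => _ _ _ []. Qed.
Lemma I1W3 : I1 *m W3 = W2. Proof. by rewrite -[W3]opprK -I1W2 mulmxN I_sqr_mul opprK. Qed.
Lemma I2W3 : I2 *m W3 = - W1. Proof. by rewrite -I2W1 I_sqr_mul. Qed.
Lemma I3W1 : I3 *m W1 = - W2. Proof. by rewrite -{1}I3W2 I_sqr_mul. Qed.

Lemma mulmx_unit_inj (W X Y : 'M[C]_n) : W \in unitmx -> X *m W = Y *m W -> X = Y.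
Proof. by move=> uW e; rewrite -(mulmxK uW X) e mulmxK. Qed.

(** Each [I_a] exchanges two of the forms up to sign, so a relation can be checked after
    multiplication by a suitable invertible [W_b]. *)
Lemma quaternion_relations :
  [/\ I2 *m I1 = I3, I3 *m I2 = I1 & I1 *m I3 = I2] /\
  [/\ I1 *m I2 = - I3, I2 *m I3 = - I1 & I3 *m I1 = - I2].
Proof.
have [u1 u2 u3 _] := W_I; split; split.
- by apply: (mulmx_unit_inj u2); rewrite -mulmxA I1W2 mulmxN I2W3 opprK I3W2.
- by apply: (mulmx_unit_inj u3); rewrite -mulmxA I2W3 mulmxN I3W1 opprK I1W3.
- by apply: (mulmx_unit_inj u1); rewrite -mulmxA I3W1 mulmxN I1W2 opprK I2W1.
- by apply: (mulmx_unit_inj u1); rewrite -mulmxA I2W1 mulNmx I1W3 I3W1 opprK.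
- by apply: (mulmx_unit_inj u2); rewrite -mulmxA I3W2 mulNmx I2W1 I1W2 opprK.
- by apply: (mulmx_unit_inj u3); rewrite -mulmxA I1W3 mulNmx I3W2 I2W3 opprK.
Qed.

(** The common value of the products [I_a *m W_a] is minus the metric. *)
Lemma I1W1 : I1 *m W1 = I3 *m W3.
Proof.
have [[_ _ _] [e _ _]] := quaternion_relations.
by rewrite -[W1]opprK -I2W3 mulmxN mulmxA e mulNmx opprK.
Qed.

Lemma I2W2 : I2 *m W2 = I1 *m W1.
Proof.
have [[_ _ _] [_ e _]] := quaternion_relations.
by rewrite -[W2]opprK -I3W1 mulmxN mulmxA e mulNmx opprK.
Qed.

Local Notation g := (2^-1 *: (Wp *m I1^T - I1 *m Wp)).

Lemma W3_I1T : W3 *m I1^T = W2.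
Proof.
by apply: oppr_inj; rewrite -W2_antisym -[in RHS]I1W3 trmx_mul W3_antisym mulNmx.
Qed.

Lemma W1_I1T : W1 *m I1^T = - (I1 *m W1).
Proof. by rewrite -[W1 in LHS]opprK -I2W3 mulNmx -mulmxA W3_I1T I2W2. Qed.

(** In Wp = W1 + i W2 the [W2] terms cancel, since W2 I1^T = I1 W2, and the [W1] terms add up, since
    W1 I1^T = - I1 W1. *)
Lemma metricE : g = - (I1 *m W1).
Proof.
have e2 : W2 *m I1^T = - W3.
  by apply: oppr_inj; rewrite -mulNmx -W2_antisym -trmx_mul I1W2 linearN /= W3_antisym.
rewrite {1 2}Wp_E mulmxDl mulmxDr -(scalemxAl 'i%C) -(scalemxAr 'i%C) W1_I1T e2 I1W2.
rewrite opprD addrACA subrr addr0.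
set X := I1 *m W1.
by rewrite -opprD -[X + X]mulr2n -[X *+ 2]scaler_nat scalerN scalerA mulVf ?two_neq0 // scale1r.
Qed.

Lemma metric_forms : [/\ W1 = I1 *m g, W2 = I2 *m g & W3 = I3 *m g].
Proof.
rewrite metricE !mulmxN I_sqr_mul opprK; split => //.
  by rewrite -I2W2 I_sqr_mul opprK.
by rewrite I1W1 I_sqr_mul opprK.
Qed.

Lemma metric_real : conjM g = g.
Proof. by rewrite metricE conjMN conjMM conjM_toC W1_real. Qed.

Lemma metric_sym : g^T = g.
Proof. by rewrite metricE linearN /= trmx_mul W1_antisym mulNmx opprK W1_I1T. Qed.

Lemma metric_unit : g \in unitmx.
Proof.
have [u1 _ _ _] := W_I; have [e1 _ _] := metric_forms.
by move: u1; rewrite {1}e1 unitmx_mul => /andP[].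
Qed.

Lemma sub_K0 m (u : 'M[C]_(m, n)) : (u <= K0)%MS <-> u *m conjM Wp = 0.
Proof. by rewrite -(split_K (sys (aff 0))) pencil0. Qed.
Lemma sub_L0 m (u : 'M[C]_(m, n)) : (u <= L0)%MS <-> u *m Wp = 0.
Proof. by rewrite -(split_L (sys (aff 0))) pencil0. Qed.
Lemma Wm_E : conjM Wp = W1 - 'i%C *: W2.
Proof. by rewrite {1}Wp_E conjMD (conjMZ 'i%C) W1_real W2_real conji scaleNr. Qed.

(** [I1] anticommutes with [I3], so it exchanges the eigenspaces [K0] and [L0] of [I3]. *)
Lemma K0_I1 m (t : 'M[C]_(m, n)) : (t <= K0)%MS -> (t *m I1 <= L0)%MS.
Proof.
move=> tK; apply/sub_L0; rewrite Wp_E -mulmxA mulmxDr -(scalemxAr 'i%C) I1W1 I1W2.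
rewrite mulmxDr mulmxA (split_J_K (sys (aff 0)) tK) -(scalemxAr 'i%C) mulmxN scalerN.
by rewrite -(scalemxAl 'i%C) subrr.
Qed.

Lemma L0_I1 m (t : 'M[C]_(m, n)) : (t <= L0)%MS -> (t *m I1 <= K0)%MS.
Proof.
move=> tL; apply/sub_K0; rewrite Wm_E -mulmxA mulmxBr -(scalemxAr 'i%C) I1W1 I1W2.
rewrite mulmxBr mulmxA (split_J_L (sys (aff 0)) tL) -(scalemxAr 'i%C) mulmxN scalerN opprK.
by rewrite -(scalemxAl (- 'i%C)) scaleNr addNr.
Qed.

(** The conjugate of [z] enters because T^(1,0) is the kernel of the conjugate form. On the vector t
    + conj(z) t I1 that form leaves only multiples of t W3 and t I1 W3, and each multiple cancels by
    i^2 = -1. *)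
Lemma K0_frame z m (t : 'M[C]_(m, n)) : (t <= K0)%MS ->
  ((t + conjc z *: (t *m I1))%R <= K (aff z))%MS.
Proof.
move=> tK; have [->|z0] := eqVneq z 0.
  by rewrite conjc_0 scale0r addr0.
have cz0 : conjc z != 0 by rewrite fmorph_eq0.
have tWm : t *m conjM Wp = 0 by apply/sub_K0.
have tIWp : t *m I1 *m Wp = 0 by apply/sub_L0; exact: K0_I1.
have tW2 : t *m W1 = 'i%C *: (t *m W2).
  by apply: subr0_eq; rewrite scalemxAr -mulmxBr -Wm_E.
have tWp : t *m Wp = (2 * 'i%C) *: (t *m I1 *m W3).
  rewrite {1}Wp_E mulmxDr tW2 -(scalemxAr 'i%C) -mulmxA I1W3 -scalerDl; congr (_ *: _).
  by rewrite mulr_natl mulr2n.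
have tIWm : t *m I1 *m conjM Wp = (2 * 'i%C) *: (t *m W3).
  rewrite Wm_E -mulmxA mulmxBr -(scalemxAr 'i%C) I1W1 I1W2.
  rewrite mulmxBr -(scalemxAr 'i%C) mulmxN scalerN opprK.
  rewrite mulmxA (split_J_K (sys (aff 0)) tK) -(scalemxAl 'i%C) -scalerDl; congr (_ *: _).
  by rewrite mulr_natl mulr2n.
apply/(split_K (sys (aff z))); rewrite pencil_neq0 // conjMB conjMD !conjMZ conjMK W3_real.
rewrite conjcN !conjcM !conjcV conjcM conjc2 conji.
rewrite mulmxBr mulmxDr -!scalemxAr !mulmxDl -!scalemxAl tWm tIWp tWp tIWm.
rewrite scaler0 add0r addr0 !scalerA.
rewrite (_ : - (- 'i%C / (2 * conjc z)) * conjc z * (2 * 'i%C) = 'i%C * 'i%C); last first.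
  by field; rewrite cz0.
rewrite (_ : - 'i%C * conjc z / 2 * (2 * 'i%C) = - ('i%C * 'i%C) * conjc z); last by field.
by rewrite iM opprK mul1r scaleN1r addrA addNr add0r subrr.
Qed.

Lemma L0_P m (u : 'M[C]_(m, n)) : (u <= L0)%MS -> u *m P0 = 0.
Proof. exact: (split_LP (sys (aff 0))). Qed.
Lemma K0_P m (u : 'M[C]_(m, n)) : (u <= K0)%MS -> u *m P0 = u.
Proof. exact: (split_P (sys (aff 0))). Qed.
Lemma P0_K m (u : 'M[C]_(m, n)) : (u *m P0 <= K0)%MS.
Proof. exact: (split_PK (sys (aff 0))). Qed.

(** A dimension count: [D] inverts [A] on [K0] up to the scalar [c], so the image of [K0] has full
    rank in [K']. *)
Lemma eqmx_K0_mul (K' A D : 'M[C]_n) (c : C) : c != 0 -> (K0 *m A <= K')%MS ->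
  K0 *m A *m D = c *: K0 -> \rank K' = \rank K0 -> (K' <= K0 *m A)%MS.
Proof.
move=> c0 sub e rk; rewrite -(geq_leqif (mxrank_leqif_sup sub)) rk.
by rewrite -(mxrank_scale_nz K0 c0) -e mxrankM_maxl.
Qed.

Lemma rank_K_eq zeta zeta' : \rank (K zeta) = \rank (K zeta').
Proof. by apply: double_inj; rewrite !(rank_K (sys _)). Qed.

Lemma normC_neq0 (z : C) : 1 + z * conjc z != 0.
Proof.
apply/eqP => /(congr1 (@complex.Re R)); case: z => a b /=; apply/eqP.
by rewrite mulrN opprK gt_eqF // ltr_pwDl // addr_ge0 // -expr2 sqr_ge0.
Qed.

(** Here (1 + conj(z) I1)(1 - z I1) = 1 + |z|^2 + (conj(z) - z) I1, and the last term sends [K0] to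
    [L0], which [P0] kills. *)
Lemma dual_frame_K0 z m (t : 'M[C]_(m, n)) : (t <= K0)%MS ->
  let y := t + conjc z *: (t *m I1) in
  (y - z *: (y *m I1)) *m P0 = (1 + z * conjc z) *: t.
Proof.
move=> tK y; have tI : t *m I1 *m P0 = 0 by rewrite L0_P // K0_I1.
have yP : y *m P0 = t by rewrite mulmxDl -scalemxAl tI scaler0 addr0 K0_P.
have yIP : y *m I1 *m P0 = - (conjc z *: t).
  by rewrite mulmxDl -scalemxAl mul_I_sqr scalerN mulmxBl tI sub0r -scalemxAl K0_P.
by rewrite mulmxBl -scalemxAl yP yIP scalerN opprK scalerA scalerDl scale1r.
Qed.

Lemma dual_frame_inf_K0 w m (t : 'M[C]_(m, n)) : (t <= K0)%MS ->
  let y := conjc w *: t + t *m I1 in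
  (w *: y - y *m I1) *m P0 = (1 + w * conjc w) *: t.
Proof.
move=> tK y; have tI : t *m I1 *m P0 = 0 by rewrite L0_P // K0_I1.
have yP : y *m P0 = conjc w *: t by rewrite mulmxDl tI addr0 -scalemxAl K0_P.
have yIP : y *m I1 *m P0 = - t.
  by rewrite mulmxDl -scalemxAl mul_I_sqr mulmxBl -scalemxAl tI scaler0 sub0r K0_P.
by rewrite mulmxBl -scalemxAl yP yIP opprK scalerA addrC scalerDl scale1r.
Qed.

Lemma sub_K_aff z (y : 'rV[C]_n) : (y <= K (aff z))%MS <->
  exists2 t : 'rV[C]_n, (t <= K0)%MS & y = t + conjc z *: (t *m I1).
Proof.
split=> [|[t tK ->]]; last exact: K0_frame.
pose A := 1%:M + conjc z *: I1.
have AE m (t : 'M[C]_(m, n)) : t *m A = t + conjc z *: (t *m I1).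
  by rewrite mulmxDr mulmx1 -scalemxAr.
have KA : (K (aff z) <= K0 *m A)%MS.
  apply: (@eqmx_K0_mul _ _ ((1%:M - z *: I1) *m P0) (1 + z * conjc z)).
  - exact: normC_neq0.
  - by rewrite AE K0_frame.
  - by rewrite mulmxA AE mulmxBr mulmx1 -scalemxAr dual_frame_K0.
  - exact: rank_K_eq.
move=> /submx_trans/(_ KA)/submxP[v ->]; exists (v *m K0); first exact: submxMl.
by rewrite mulmxA AE.
Qed.

Lemma sub_K_affoo w (y : 'rV[C]_n) : (y <= K (affoo w))%MS <->
  exists2 t : 'rV[C]_n, (t <= K0)%MS & y = conjc w *: t + t *m I1.
Proof.
(* At infinity the form is the conjugate of [Wp], so the (1,0)-space is [L0], the image of [K0]
   under [I1]. Elsewhere the two frames differ by the scalar conj(w). *)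
rewrite /affoo; have [->|w0] := eqVneq w 0.
  rewrite -(split_K (sys None)) conjMK -sub_L0 conjc_0; split=> [yL|[t tK ->]].
    exists (- (y *m I1)); first by rewrite eqmx_opp L0_I1.
    by rewrite scale0r add0r mulNmx mul_I_sqr opprK.
  by rewrite scale0r add0r K0_I1.
have cw0 : conjc w != 0 by rewrite fmorph_eq0.
rewrite -/(aff w^-1) sub_K_aff conjcV; split=> -[t tK ->].
  exists ((conjc w)^-1 *: t); first exact: scalemx_sub.
  by rewrite scalerA divff // scale1r -scalemxAl.
exists (conjc w *: t); first exact: scalemx_sub.
by rewrite -scalemxAl scalerA mulVf // scale1r.
Qed.

Lemma K_aff_inv z (y : 'rV[C]_n) : (y <= K (aff z))%MS ->
  forall v, (y - z *: (y *m I1)) *m P0 = v ->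
  y = (1 + z * conjc z)^-1 *: (v + conjc z *: (v *m I1)).
Proof.
move=> /sub_K_aff[t tK ->] v; rewrite dual_frame_K0 // => <-; rewrite -scalemxAl.
rewrite [conjc z *: (_ *: _)]scalerA [conjc z * _]mulrC -scalerA -scalerDr.
by rewrite scalerA mulVf ?normC_neq0 // scale1r.
Qed.

Lemma K_affoo_inv w (y : 'rV[C]_n) : (y <= K (affoo w))%MS ->
  forall v, (w *: y - y *m I1) *m P0 = v ->
  y = (1 + w * conjc w)^-1 *: (conjc w *: v + v *m I1).
Proof.
move=> /sub_K_affoo[t tK ->] v; rewrite dual_frame_inf_K0 // => <-; rewrite -scalemxAl.
rewrite [conjc w *: (_ *: _)]scalerA [conjc w * _]mulrC -scalerA -scalerDr.
by rewrite scalerA mulVf ?normC_neq0 // scale1r.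
Qed.

(** Covectors vanishing on [L0] see exactly the component along [K0]; testing against all of them
    becomes one matrix equation. *)
Lemma cotangent_ext (a b : 'rV[C]_n) :
  (forall tau : 'cV[C]_n, L0 *m tau = 0 -> a *m tau = b *m tau) <-> a *m P0 = b *m P0.
Proof.
split=> [ab|ab tau Lt].
  apply/row_matrixP => i; apply/rowP => j.
  have e := ab (P0 *m delta_mx j 0); rewrite !mulmxA (split_LP0 (sys (aff 0))) mul0mx in e.
  have := congr1 (fun M : 'M[C]_1 => M 0 0) (e erefl); rewrite -!colE !mxE.
  by rewrite (ord1 i).
have Qt : Q (aff 0) *m tau = 0.
  have := split_QL (sys (aff 0)) 1%:M; rewrite mul1mx => /submxP[D ->].
  by rewrite -mulmxA Lt mulmx0.
by rewrite -[tau]mul1mx -(split_sum (sys (aff 0))) mulmxDl Qt addr0 !mulmxA ab.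
Qed.

End QuaternionicPoint.

(** * Real holomorphic sections *)

Section VectorSmooth.
Context {R : realType} {n : nat}.
Local Notation C := R[i].

Definition vsmooth m (F : R * R -> 'rV[C]_m) :=
  forall k : 'I_m, csmooth_on setT (fun p : R * R => F p 0 k).

Lemma vsmooth_eq m (F G : R * R -> 'rV[C]_m) : F =1 G -> vsmooth F -> vsmooth G.
Proof. by move/funext => ->. Qed.

Lemma vsmooth_cst m (a : 'rV[C]_m) : vsmooth (fun=> a).
Proof. by move=> k; exact: csmooth_on_cst. Qed.

Lemma vsmoothD m (F G : R * R -> 'rV[C]_m) : vsmooth F -> vsmooth G ->
  vsmooth (fun p => F p + G p).
Proof.
move=> sF sG k; apply: (csmooth_on_eq (F := fun p => F p 0 k + G p 0 k)); last exact: csmooth_onD.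
by move=> p; rewrite mxE.
Qed.

Lemma vsmoothZ m (f : R * R -> C) (F : R * R -> 'rV[C]_m) : csmooth_on setT f -> vsmooth F ->
  vsmooth (fun p => f p *: F p).
Proof.
move=> sf sF k; apply: (csmooth_on_eq (F := fun p => f p * F p 0 k)); last exact: csmooth_onM.
by move=> p; rewrite mxE.
Qed.

Lemma vsmooth_mul m k (F : R * R -> 'rV[C]_m) (A : 'M[C]_(m, k)) : vsmooth F ->
  vsmooth (fun p => F p *m A).
Proof.
move=> sF j; apply: (csmooth_on_eq (F := fun p => \sum_i F p 0 i * A i j)).
  by move=> p; rewrite mxE.
by apply: csmooth_on_sum => i; apply: csmooth_onM; [exact: sF | exact: csmooth_on_cst].
Qed.

Lemma vsmoothB m (F G : R * R -> 'rV[C]_m) : vsmooth F -> vsmooth G ->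
  vsmooth (fun p => F p - G p).
Proof.
move=> sF sG; apply: (vsmooth_eq (F := fun p => F p + (-1) *: G p)) => [p|].
  by rewrite scaleN1r.
by apply: vsmoothD => //; apply: vsmoothZ => //; exact: csmooth_on_cst.
Qed.

Lemma continuous_eq0 (d : R * R -> R) : {for 0, continuous d} ->
  (forall p, p != 0 -> d p = 0) -> d 0 = 0.
Proof.
move=> cd d0; apply/eqP; rewrite -normr_le0 leNgt; apply/negP => n0.
move/cvgrPdist_lt : cd => /(_ _ n0); rewrite -nbhs_nearE => /nbhs_ballP[r /= r0 Hr].
pose p : R * R := (r / 2, 0).
have r20 : 0 < r / 2 by rewrite divr_gt0.
have p0 : p != 0 by apply/eqP => -[/eqP]; rewrite gt_eqF.
have pb : ball (0 : R * R) r p.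
  rewrite -ball_normE /= sub0r normrN prod_normE /= normr0 gt_max r0 andbT gtr0_norm //.
  by rewrite ltr_pdivrMr // ltr_pMr // ltr1n.
by have := Hr p pb; rewrite (d0 _ p0) subr0 ltxx.
Qed.

(** Continuity at the origin of the chart around infinity recovers the value at infinity from the
    values on C. *)
Lemma vsmooth_eq0 m (F G : R * R -> 'rV[C]_m) : vsmooth F -> vsmooth G ->
  (forall p, p != 0 -> F p = G p) -> F 0 = G 0.
Proof.
move=> sF sG FG; apply: subr0_eq; apply/rowP => k; rewrite [RHS]mxE.
have [sr si] := vsmoothB sF sG k.
have e0 p : p != 0 -> (F p - G p) 0 k = 0 by move=> /FG ->; rewrite subrr mxE.
have cr := (sr 0).1 0 I; have ci := (si 0).1 0 I.
have := continuous_eq0 cr (fun p p0 => congr1 (@complex.Re R) (e0 p p0)).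
have := continuous_eq0 ci (fun p p0 => congr1 (@complex.Im R) (e0 p p0)).
by case: ((F 0 - G 0) 0 k) => a b /= -> ->.
Qed.

End VectorSmooth.

(** * The section attached to a real tangent vector *)

Section RealHolomorphicSections.
Context {R : realType} {n : nat}.
Local Notation C := R[i].
Context {Wp W3 : 'M[C]_n} {K L P Q : P1 (R := R) -> 'M[C]_n} {Jr : P1 (R := R) -> 'M[R]_n}.
Local Notation B := (pencil Wp W3 (conjM Wp)).
Context (W3_real : conjM W3 = W3).
Context (sys : forall zeta,
  split_system (B zeta) (K zeta) (L zeta) (P zeta) (Q zeta) (toC (Jr zeta))).
Local Notation I1 := (toC (Jr (aff 'i%C))).
Local Notation K0 := (K (aff 0)).
Local Notation L0 := (L (aff 0)).
Local Notation P0 := (P (aff 0)).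

Lemma affoo_neq0 (w : C) : w != 0 -> affoo w = aff w^-1.
Proof. by move=> w0; rewrite /affoo (negPf w0). Qed.
Lemma affoo0 : affoo (0 : C) = None.
Proof. by rewrite /affoo eqxx. Qed.
Lemma antipode0 : antipode (aff (0 : C)) = None.
Proof. by rewrite /= eqxx. Qed.

Lemma pencil_antipode zeta : B (antipode zeta) = conjM (B zeta).
Proof.
case: zeta => [z|]; last by rewrite -/(aff 0) pencil0 /= conjMK.
have [->|z0] := eqVneq z 0; first by rewrite antipode0 pencil0.
have cz0 : conjc z != 0 by rewrite fmorph_eq0.
rewrite /antipode (negPf z0) -/(aff _) -/(aff z) !pencil_neq0 ?oppr_eq0 ?invr_eq0 //.
rewrite conjMB conjMD !conjMZ conjMK W3_real.
rewrite conjcN !conjcM !conjcV conjcM conjc2 conji.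
rewrite (_ : - ('i%C / (2 * - (conjc z)^-1)) = - (- 'i%C * conjc z / 2)); last first.
  by field; rewrite ?cz0 ?oppr_eq0 ?oner_eq0.
rewrite (_ : - (- 'i%C / (2 * conjc z)) = - ('i%C * - (conjc z)^-1 / 2)); last first.
  by field; rewrite ?cz0.
by rewrite !(scaleNr _ Wp) !(scaleNr _ (conjM Wp)) addrAC [RHS]addrAC [X in X + _ = _]addrC.
Qed.

(** The antipode conjugates the form, which exchanges the kernels [K] and [L]. *)
Lemma P_antipode zeta : P (antipode zeta) = Q zeta.
Proof.
have s := sys (antipode zeta); rewrite pencil_antipode in s.
have LK : (L zeta <= K (antipode zeta))%MS.
  by apply/(split_K s); rewrite conjMK; apply/(split_L (sys zeta)).
have KL : (K zeta <= L (antipode zeta))%MS.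
  by apply/(split_L s); apply/(split_K (sys zeta)).
apply: (split_ext (sys zeta)); first by rewrite (split_P s LK) (split_LQ (sys zeta)).
by rewrite (split_LP s KL) (split_KQ0 (sys zeta)).
Qed.

(** Reality of the section attached to [u]: the conjugate of the (1,0)-part of a real vector is its
    (0,1)-part. *)
Lemma conjM_dual_frame zeta m (u : 'M[R]_(m, n)) :
  conjM (toC u *m P zeta) = toC u *m P (antipode zeta).
Proof. by rewrite conjMM conjM_toC (conj_P (sys zeta)) P_antipode. Qed.

Lemma toC_P_conj zeta m (u : 'M[R]_(m, n)) :
  toC u = toC u *m P zeta + conjM (toC u *m P zeta).
Proof. by rewrite conjMM conjM_toC (conj_P (sys zeta)) -(split_decomp (sys zeta)). Qed.

Lemma conj_K0 m (a : 'M[C]_(m, n)) : (a <= K0)%MS -> (conjM a <= L0)%MS.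
Proof. by move/(conj_sub_L (sys (aff 0))). Qed.

(** The dual frame consists of (1,0)-covectors for J^(z). A vector of [L (aff z)] is t' + z t' I1
    with t' in [L0], and (1 + z I1)(1 - z I1) = 1 + z^2 keeps it in [L0]. *)
Lemma L_frame z (x : 'rV[C]_n) : (x <= L (aff z))%MS -> (x - z *: (x *m I1)) *m P0 = 0.
Proof.
move/(conj_sub_K (sys (aff z)))/(sub_K_aff W3_real sys) => [t tK /(congr1 (@conjM R _ _))].
rewrite conjMK conjMD conjMZ conjMM conjM_toC conjcK => ->.
have ctL := conj_K0 tK; apply: (L0_P sys).
rewrite mulmxDl -scalemxAl (mul_I_sqr sys) scalerDr opprD addrA addrK !scalerN opprK.
by rewrite addmx_sub // !scalemx_sub.
Qed.

Lemma L_frame_inf w (x : 'rV[C]_n) : (x <= L (affoo w))%MS -> (w *: x - x *m I1) *m P0 = 0.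
Proof.
move/(conj_sub_K (sys (affoo w)))/(sub_K_affoo W3_real sys) => [t tK /(congr1 (@conjM R _ _))].
rewrite conjMK conjMD conjMZ conjMM conjM_toC conjcK => ->.
have ctL := conj_K0 tK; apply: (L0_P sys).
rewrite mulmxDl -scalemxAl (mul_I_sqr sys) scalerDr opprD opprK addrA addrK.
by rewrite addmx_sub // !scalemx_sub.
Qed.

Lemma frame_addr (A D : 'M[C]_n) z (x y : 'rV[C]_n) : (x - z *: (x *m A)) *m D = 0 ->
  (y - z *: (y *m A)) *m D = (y + x - z *: ((y + x) *m A)) *m D.
Proof.
move=> h; rewrite [(y + x) *m A]mulmxDl scalerDr opprD addrACA [RHS]mulmxDl.
by rewrite [X in _ = _ + X]h addr0.
Qed.

Lemma frame_inf_addr (A D : 'M[C]_n) w (x y : 'rV[C]_n) : (w *: x - x *m A) *m D = 0 ->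
  (w *: y - y *m A) *m D = (w *: (y + x) - (y + x) *m A) *m D.
Proof.
move=> h; rewrite [(y + x) *m A]mulmxDl scalerDr opprD addrACA [RHS]mulmxDl.
by rewrite [X in _ = _ + X]h addr0.
Qed.

Section Section_of_vector.
Context (u : 'rV[R]_n).
Local Notation S := (fun zeta => toC u *m P zeta).
Local Notation a := (toC u *m P0).
Local Notation b := (conjM (toC u *m P0) *m I1).

(** The (0,1)-part of [u] is invisible to the dual frame, so the vector [u], constant in [z],
    replaces its (1,0)-part and the right-hand side is affine in [z]. *)
Lemma toC_aff z :
  (S (aff z) - z *: (S (aff z) *m I1)) *m P0 = (toC u - z *: (toC u *m I1)) *m P0.
Proof.
have h := L_frame (split_QL (sys (aff z)) (toC u)).
by apply: etrans (frame_addr _ h) _; rewrite -(split_decomp (sys (aff z)) (toC u)).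
Qed.

Lemma toC_affoo w :
  (w *: S (affoo w) - S (affoo w) *m I1) *m P0 = (w *: toC u - toC u *m I1) *m P0.
Proof.
have h := L_frame_inf (split_QL (sys (affoo w)) (toC u)).
by apply: etrans (frame_inf_addr _ h) _; rewrite -(split_decomp (sys (affoo w)) (toC u)).
Qed.

(** As [I1] exchanges [K0] and [L0], only the (0,1)-part conj(a) of [u] contributes. *)
Lemma toC_I1_P0 : toC u *m I1 *m P0 = b.
Proof.
rewrite {1}(toC_P_conj (aff 0) u) mulmxDl mulmxDl.
have aK : (a <= K0)%MS by exact: (P0_K sys).
rewrite (L0_P sys (K0_I1 W3_real sys aK)) add0r (K0_P sys) //.
exact: (L0_I1 W3_real sys (conj_K0 aK)).
Qed.

Lemma section_aff z : (S (aff z) - z *: (S (aff z) *m I1)) *m P0 = a - z *: b.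
Proof. by rewrite toC_aff mulmxBl -scalemxAl toC_I1_P0. Qed.

Lemma section_affoo w : (w *: S (affoo w) - S (affoo w) *m I1) *m P0 = w *: a - b.
Proof. by rewrite toC_affoo mulmxBl -scalemxAl toC_I1_P0. Qed.

Lemma section_affE z : S (aff z) =
  (1 + z * conjc z)^-1 *: ((a - z *: b) + conjc z *: ((a - z *: b) *m I1)).
Proof.
have SK : (S (aff z) <= K (aff z))%MS by exact: split_PK (sys _) _ _.
exact: (K_aff_inv W3_real sys SK (section_aff z)).
Qed.

Lemma section_affooE w : S (affoo w) =
  (1 + w * conjc w)^-1 *: (conjc w *: (w *: a - b) + (w *: a - b) *m I1).
Proof.
have SK : (S (affoo w) <= K (affoo w))%MS by exact: split_PK (sys _) _ _.
exact: (K_affoo_inv W3_real sys SK (section_affoo w)).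
Qed.

Lemma section_smooth c : standard_chart c -> vsmooth (fun p : R * R => S (c (plane p))).
Proof.
have sp := @csmooth_on_plane R; have sc := csmooth_on_conj sp.
have sa : vsmooth (fun p : R * R => a - plane p *: b).
  by apply: vsmoothB; [|apply: vsmoothZ => //]; exact: vsmooth_cst.
have so : vsmooth (fun p : R * R => plane p *: a - b).
  by apply: vsmoothB; [apply: vsmoothZ => //|]; exact: vsmooth_cst.
case=> ->.
  apply: (vsmooth_eq (fun p => esym (section_affE (plane p)))).
  apply: vsmoothZ; first exact: csmooth_on_planeV.
  by apply: vsmoothD => //; apply: vsmoothZ => //; exact: vsmooth_mul.
apply: (vsmooth_eq (fun p => esym (section_affooE (plane p)))).
apply: vsmoothZ; first exact: csmooth_on_planeV.
by apply: vsmoothD; [apply: vsmoothZ | exact: vsmooth_mul].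
Qed.

Lemma P0_cotangent (tau : 'cV[C]_n) : L0 *m tau = 0 -> P0 *m tau = tau.
Proof.
move=> Lt; apply/row_matrixP => i; rewrite !rowE mulmxA.
apply: (cotangent_ext sys (delta_mx 0 i *m P0) (delta_mx 0 i)).2 Lt.
exact: (K0_P sys (P0_K sys _)).
Qed.

Lemma section_holomorphic (tau : 'cV[C]_n) : L0 *m tau = 0 ->
    (forall z : C^o,
       derivable (fun z : C^o => (S (aff z) *m (tau - z *: (I1 *m tau))) 0 0 : C^o) z 1) /\
    (forall w : C^o,
       derivable (fun w : C^o => (S (affoo w) *m (w *: tau - I1 *m tau)) 0 0 : C^o) w 1).
Proof.
move=> Lt; have Pt := P0_cotangent Lt; split=> z.
  have -> : (fun z : C^o => (S (aff z) *m (tau - z *: (I1 *m tau))) 0 0 : C^o) =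
      (fun z : C^o => (a *m tau) 0 0 - z * (b *m tau) 0 0).
    apply/funext => y; rewrite mulmxBr -scalemxAr mulmxA scalemxAl -mulmxBl -[in LHS]Pt.
    by rewrite mulmxA section_aff mulmxBl -scalemxAl !mxE.
  have d : is_derive z (1 : C^o) (fun z : C^o => (a *m tau) 0 0 - z * (b *m tau) 0 0 : C^o)
      (- (b *m tau) 0 0 : C^o).
    by apply: is_derive_affine => k; rewrite /GRing.scale /=; ring.
  exact: (@ex_derive _ _ _ _ _ _ _ d).
have -> : (fun z : C^o => (S (affoo z) *m (z *: tau - I1 *m tau)) 0 0 : C^o) =
    (fun z : C^o => z * (a *m tau) 0 0 - (b *m tau) 0 0).
  apply/funext => y; rewrite mulmxBr -scalemxAr mulmxA scalemxAl -mulmxBl -[in LHS]Pt.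
  by rewrite mulmxA section_affoo mulmxBl -scalemxAl !mxE.
have d : is_derive z (1 : C^o) (fun z : C^o => z * (a *m tau) 0 0 - (b *m tau) 0 0 : C^o)
    ((a *m tau) 0 0 : C^o).
  by apply: is_derive_affine => k; rewrite /GRing.scale /=; ring.
exact: (@ex_derive _ _ _ _ _ _ _ d).
Qed.

End Section_of_vector.

End RealHolomorphicSections.

(** * Real holomorphic sections are the sections attached to real vectors *)

Section SectionSpace.
Context {R : realType} {n : nat}.
Local Notation C := R[i].
Context {Wp W3 : 'M[C]_n} {K L P Q : P1 (R := R) -> 'M[C]_n} {Jr : P1 (R := R) -> 'M[R]_n}.
Local Notation B := (pencil Wp W3 (conjM Wp)).
Context (W3_real : conjM W3 = W3).
Context (sys : forall zeta,
  split_system (B zeta) (K zeta) (L zeta) (P zeta) (Q zeta) (toC (Jr zeta))).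
Local Notation I1 := (toC (Jr (aff 'i%C))).
Local Notation K0 := (K (aff 0)).
Local Notation L0 := (L (aff 0)).
Local Notation P0 := (P (aff 0)).
Local Notation S u := (fun zeta => toC u *m P zeta).
Local Notation j a := (conjM a *m I1).

Lemma j_K0 (a : 'rV[C]_n) : (a <= K0)%MS -> (j a <= K0)%MS.
Proof. by move=> aK; exact: (L0_I1 W3_real sys (conj_K0 sys aK)). Qed.

Lemma j_antilinear (l : C) (a b : 'rV[C]_n) : j (l *: a + b) = conjc l *: j a + j b.
Proof. by rewrite conjMD conjMZ mulmxDl -scalemxAl. Qed.

Lemma j_sqr (a : 'rV[C]_n) : j (j a) = - a.
Proof. by rewrite conjMM conjMK conjM_toC (mul_I_sqr sys). Qed.

(** This and the next three definitions restate the notions of section over the abstract [K], [L]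
    and [Jr]; [H0RE] and [representedE] translate back to the concrete kernels. *)
Definition normal_like (s : P1 -> 'rV[C]_n) :=
  (forall zeta, (s zeta <= K zeta)%MS) /\
  forall c, standard_chart c -> vsmooth (fun p : R * R => s (c (plane p))).

Definition holomorphic_like (s : P1 -> 'rV[C]_n) :=
  forall tau : 'cV[C]_n, L0 *m tau = 0 ->
    (forall z : C^o,
       derivable (fun z : C^o => (s (aff z) *m (tau - z *: (I1 *m tau))) 0 0 : C^o) z 1) /\
    (forall w : C^o,
       derivable (fun w : C^o => (s (affoo w) *m (w *: tau - I1 *m tau)) 0 0 : C^o) w 1).

Definition H0_like s := [/\ normal_like s, real_section s & holomorphic_like s].

Definition represented_like (s : P1 -> 'rV[C]_n) (v : C -> 'rV[C]_n) :=
  forall z, (v z <= K0)%MS /\ forall tau : 'cV[C]_n, L0 *m tau = 0 ->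
    v z *m tau = (s (aff z) - z *: (s (aff z) *m I1)) *m tau.

Lemma section_H0 u : H0_like (S u).
Proof.
split.
- split=> [zeta|c cc]; first exact: (split_PK (sys zeta)).
  exact: (section_smooth W3_real sys).
- by move=> zeta; exact: (conjM_dual_frame W3_real sys).
- by move=> tau Lt; exact: (section_holomorphic W3_real sys).
Qed.

Lemma normal_ext s t : normal_like s -> normal_like t ->
  (forall z, s (aff z) = t (aff z)) -> s = t.
Proof.
move=> [_ ss] [_ st] st0; apply/funext => -[z|]; first exact: st0.
have so := ss _ (or_intror erefl); have to := st _ (or_intror erefl).
have pl0 : affoo (plane (0 : R * R)) = None by exact: affoo0.
have e : s (affoo (plane (0 : R * R))) = t (affoo (plane (0 : R * R))).
  apply: (vsmooth_eq0 so to) => p p0; rewrite affoo_neq0; first exact: st0.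
  apply: contra p0 => /eqP; case: p => x y []; rewrite /= => -> ->; exact: eqxx.
by rewrite pl0 in e.
Qed.

Lemma vector_of (a : 'rV[C]_n) : (a <= K0)%MS -> exists u : 'rV[R]_n, toC u *m P0 = a.
Proof.
(* The vector a + conj(a) is real, and its (1,0)-part is [a] because conj(a) lies in [L0]. *)
move=> aK; exists (map_mx (@complex.Re R) (a + conjM a)).
rewrite toC_Re; last by rewrite conjMD conjMK addrC.
by rewrite mulmxDl (K0_P sys aK) (L0_P sys (conj_K0 sys aK)) addr0.
Qed.

(** A real vector is twice the real part of its (1,0)-part, for any one of the complex
    structures. *)
Lemma section_at_inj zeta (u v : 'rV[R]_n) : toC u *m P zeta = toC v *m P zeta -> u = v.
Proof.
move=> e; apply: toC_inj.
by rewrite (toC_P_conj sys zeta u) (toC_P_conj sys zeta v) e.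
Qed.

Lemma represented_likeE s v z : represented_like s v ->
  v z = (s (aff z) - z *: (s (aff z) *m I1)) *m P0.
Proof.
move=> /(_ z)[vK vE]; rewrite -{1}(K0_P sys vK).
by apply/(cotangent_ext sys) => tau Lt; rewrite vE.
Qed.

Lemma section_represented u :
  represented_like (S u) (fun z => toC u *m P0 - z *: j (toC u *m P0)).
Proof.
move=> z; have aK : (toC u *m P0 <= K0)%MS by exact: (P0_K sys).
have vK : ((toC u *m P0 - z *: j (toC u *m P0))%R <= K0)%MS.
  by rewrite addmx_sub // eqmx_opp scalemx_sub // j_K0.
split; first exact: vK.
apply/(cotangent_ext sys); apply: etrans (K0_P sys vK) _; apply/esym.
exact: (section_aff W3_real sys u z).
Qed.

Lemma represented_section s u : normal_like s ->
  represented_like s (fun z => toC u *m P0 - z *: j (toC u *m P0)) -> s = S u.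
Proof.
move=> ns rep; have [nu _ _] := section_H0 u.
apply: normal_ext => // z; rewrite (section_affE W3_real sys).
exact: (K_aff_inv W3_real sys (ns.1 (aff z)) (esym (represented_likeE z rep))).
Qed.

(** The values at z = 0 and z = 1 give both coefficients. Any operator describing the real sections
    must thus agree with [j] on the coefficients that occur. *)
Lemma represented_uniq u a b : represented_like (S u) (fun z => a - z *: b) ->
  a = toC u *m P0 /\ b = j (toC u *m P0).
Proof.
move=> rep; have e z : a - z *: b = toC u *m P0 - z *: j (toC u *m P0).
  rewrite (represented_likeE z rep); exact: (section_aff W3_real sys u z).
have ea : a = toC u *m P0 by have := e 0; rewrite !scale0r !subr0.
split; first exact: ea.
by have := e 1; rewrite ea !scale1r => /addrI /oppr_inj.
Qed.

Lemma dual_frameE (A : 'M[C]_n) z (y : 'rV[C]_n) (tau : 'cV[C]_n) :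
  y *m (tau - z *: (A *m tau)) = (y - z *: (y *m A)) *m tau.
Proof. by rewrite mulmxBr mulmxBl -scalemxAr -scalemxAl mulmxA. Qed.

Lemma dual_frame_infE (A : 'M[C]_n) w (y : 'rV[C]_n) (tau : 'cV[C]_n) :
  y *m (w *: tau - A *m tau) = (w *: y - y *m A) *m tau.
Proof. by rewrite mulmxBr mulmxBl -scalemxAr -scalemxAl mulmxA. Qed.

(* At infinity a real section takes the value conj (s 0), which fixes the slope of
   the affine function representing it. *)
Lemma H0_represented s : H0_like s ->
  represented_like s (fun z => s (aff 0) - z *: j (s (aff 0))).
Proof.
move=> [[sK ss] sr sh]; have aK := sK (aff 0); set a := s (aff 0) in aK *.
have s_inf : s None = conjM a by rewrite -antipode0 -sr.
have vK z : ((a - z *: j a)%R <= K0)%MS.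
  by rewrite addmx_sub // eqmx_opp scalemx_sub // j_K0.
move=> z; split; first exact: vK.
apply/(cotangent_ext sys); apply: etrans (K0_P sys (vK z)) _.
apply/rowP => k; pose tau : 'cV[C]_n := P0 *m delta_mx k 0.
have Lt : L0 *m tau = 0 by rewrite mulmxA (split_LP0 (sys (aff 0))) mul0mx.
(* [f] is the k-th coordinate of the representative, and [f'] its counterpart in the chart at
   infinity. The frames differ by the factor w, so f' w = w f (1/w), and the slope of [f] is
   [f' 0]. *)
pose f y := (s (aff y) *m (tau - y *: (I1 *m tau))) 0 0.
pose f' y := (s (affoo y) *m (y *: tau - I1 *m tau)) 0 0.
have sf : csmooth_on setT (fun p : R * R => f (plane p)).
  have s0 := ss _ (or_introl erefl).
  have := vsmoothB (vsmooth_mul tau s0)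
    (vsmoothZ (@csmooth_on_plane R) (vsmooth_mul (I1 *m tau) s0)).
  move=> /(_ 0); apply: csmooth_on_eq => p.
  by rewrite /f mulmxBr -scalemxAr.
have [df df'] := sh tau Lt.
have ff' w : w != 0 -> f' w = w * f w^-1.
  move=> w0; rewrite /f /f' affoo_neq0 //.
  rewrite !mulmxBr -!scalemxAr !mxE mulrBr [w * (w^-1 * _)]mulrA divff // mul1r.
  by [].
have e : f z = f 0 + z * f' 0 := entire_affine sf df (df' 0) ff' z.
have f0E : f 0 = (a *m tau) 0 0 by rewrite /f scale0r subr0.
have f'0E : f' 0 = - (conjM a *m I1 *m tau) 0 0.
  by rewrite /f' affoo0 s_inf scale0r sub0r mulmxN mulmxA mxE.
have -> : ((s (aff z) - z *: (s (aff z) *m I1)) *m P0) 0 k = f z.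
  by rewrite /f dual_frameE /tau mulmxA -colE [RHS]mxE.
rewrite e f0E f'0E /tau !mulmxA (K0_P sys aK) (K0_P sys (j_K0 aK)) -!colE.
by rewrite !(mxE, mulrN).
Qed.

Lemma H0_section s : H0_like s -> exists u, s = S u.
Proof.
move=> sH; have [ns _ _] := sH; have [u ue] := vector_of (ns.1 (aff 0)).
have rep := H0_represented sH; rewrite -ue in rep.
by exists u; exact: (represented_section ns rep).
Qed.

Lemma dual_frame_iso z (v : 'rV[C]_n) : (v <= K0)%MS ->
  exists! y : 'rV[C]_n, (y <= K (aff z))%MS /\
    forall tau : 'cV[C]_n, L0 *m tau = 0 -> v *m tau = y *m (tau - z *: (I1 *m tau)).
Proof.
move=> vK; pose t := (1 + z * conjc z)^-1 *: v.
have tK : (t <= K0)%MS by exact: scalemx_sub.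
exists (t + conjc z *: (t *m I1)); split.
  split; first exact: (K0_frame W3_real sys).
  move=> tau Lt; rewrite dual_frameE; move: tau Lt; apply/(cotangent_ext sys).
  rewrite (dual_frame_K0 W3_real sys z tK) (K0_P sys vK).
  by rewrite scalerA divff ?normC_neq0 // scale1r.
move=> y [yK yE]; have e : v *m P0 = (y - z *: (y *m I1)) *m P0.
  by apply/(cotangent_ext sys) => tau /yE ->; rewrite dual_frameE.
have := K_aff_inv W3_real sys yK (esym e); rewrite (K0_P sys vK) => ->.
by rewrite /t -scalemxAl scalerA [conjc z * _]mulrC -scalerA -scalerDr.
Qed.

Lemma dual_frame_inf_iso w (v : 'rV[C]_n) : (v <= K0)%MS ->
  exists! y : 'rV[C]_n, (y <= K (affoo w))%MS /\
    forall tau : 'cV[C]_n, L0 *m tau = 0 -> v *m tau = y *m (w *: tau - I1 *m tau).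
Proof.
move=> vK; pose t := (1 + w * conjc w)^-1 *: v.
have tK : (t <= K0)%MS by exact: scalemx_sub.
exists (conjc w *: t + t *m I1); split.
  split; first by apply/(sub_K_affoo W3_real sys); exists t.
  move=> tau Lt; rewrite dual_frame_infE; move: tau Lt; apply/(cotangent_ext sys).
  rewrite (dual_frame_inf_K0 W3_real sys w tK) (K0_P sys vK).
  by rewrite scalerA divff ?normC_neq0 // scale1r.
move=> y [yK yE]; have e : v *m P0 = (w *: y - y *m I1) *m P0.
  by apply/(cotangent_ext sys) => tau /yE ->; rewrite dual_frame_infE.
have := K_affoo_inv W3_real sys yK (esym e); rewrite (K0_P sys vK) => ->.
by rewrite /t -scalemxAl scalerA [conjc w * _]mulrC -scalerA -scalerDr.
Qed.

Lemma section_J zeta (u : 'rV[R]_n) : toC (u *m Jr zeta) *m P zeta = 'i%C *: (toC u *m P zeta).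
Proof. by rewrite toCM -mulmxA (split_JP (sys zeta)) -scalemxAr. Qed.

Lemma bilD (X Y : 'M[C]_n) u w : bil (X + Y) u w = bil X u w + bil Y u w.
Proof. by rewrite /bil mulmxDr mulmxDl mxE. Qed.
Lemma bilN (X : 'M[C]_n) u w : bil (- X) u w = - bil X u w.
Proof. by rewrite /bil mulmxN mulNmx mxE. Qed.
Lemma bilZ a (X : 'M[C]_n) u w : bil (a *: X) u w = a * bil X u w.
Proof. by rewrite /bil -scalemxAr -scalemxAl mxE. Qed.

Lemma bil_mull (A X : 'M[C]_n) u w : bil (A *m X) u w = bil X (u *m A) w.
Proof. by rewrite /bil mulmxA. Qed.
Lemma bil_mulr (A X : 'M[C]_n) u w : bil (X *m A^T) u w = bil X u (w *m A).
Proof. by rewrite /bil trmx_mul !mulmxA. Qed.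

(** [Wp] sees only the (1,0)-parts for J^(0), and the (1,0)-part of u I1 is [j] applied to that of
    [u]. *)
Lemma metric_bil (u w : 'rV[R]_n) :
  bil (2^-1 *: (Wp *m I1^T - I1 *m Wp)) (toC u) (toC w) =
  2^-1 * (bil Wp (toC u *m P0) (j (toC w *m P0)) - bil Wp (j (toC u *m P0)) (toC w *m P0)).
Proof.
have BP (x y : 'rV[C]_n) : bil Wp (x *m P0) (y *m P0) = bil Wp x y.
  by have := bil_P (sys (aff 0)) x y; rewrite pencil0.
have e1 := bil_mulr I1 Wp (toC u) (toC w); have e2 := bil_mull I1 Wp (toC u) (toC w).
rewrite -BP (toC_I1_P0 W3_real sys) in e1; rewrite -BP (toC_I1_P0 W3_real sys) in e2.
by rewrite bilZ bilD bilN; congr (_ * (_ - _)); [exact: e1 | exact: e2].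
Qed.

Lemma bil_section zeta (u w : 'rV[R]_n) :
  bil (B zeta) (toC u *m P zeta) (toC w *m P zeta) = bil (B zeta) (toC u) (toC w).
Proof. exact: (bil_P (sys zeta)). Qed.

Lemma bil_pencil (X Y Z : 'M[C]_n) zeta u w : bil (pencil X Y Z zeta) u w =
  pencil (V := C^o) (bil X u w) (bil Y u w) (bil Z u w) zeta.
Proof.
case: zeta => [z|] //=; case: (z == 0) => //.
by rewrite !bilD bilN !bilZ.
Qed.

End SectionSpace.

(** * The twistor family *)

Section ClosedForms.
Context {R : realType} {n : nat} {M : smoothManifold R n}.
Local Notation C := R[i].

Lemma toC_congr (A X : 'M[R]_n) : toC A *m toC X *m (toC A)^T = toC (A *m X *m A^T).
Proof. by rewrite !toCM; congr (_ *m _); apply/matrixP => i k; rewrite !mxE. Qed.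

Lemma cderive_real (V : normedModType R) (v : V) (g : V -> R) y :
  cderive v (fun y => (g y)%:C) y = ('D_v g y)%:C.
Proof. by rewrite /cderive /=; congr (_ +i* _); exact: derive_cst. Qed.

(** [f] stands for [complex.Re] or [complex.Im], so that both parts of a form are treated at
    once. *)
Lemma closed_two_form_real (f : C -> R) (w X : formField M) :
  f 0 = 0 -> {morph f : a b / a + b >-> a + b} -> {morph f : a / - a >-> - a} ->
  (forall V : normedModType R, forall (v : V) (F : V -> C) y,
     'D_v (fun y => f (F y)) y = f (cderive v F y)) ->
  (forall (V : normedModType R) (U : set V) (F : V -> C), csmooth_on U F ->
     smooth_on U (fun y => f (F y))) ->
  (forall m y i j, local_form X m y i j = (f (local_form w m y i j))%:C) ->
  (forall x i j, X x i j = (f (w x i j))%:C) ->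
  closed_two_form w -> closed_two_form X.
Proof.
move=> f0 fD fN fder fsm XE Xw [sw aw cw]; split.
- move=> m i j; apply: (csmooth_on_eq (F := fun y => (f (local_form w m y i j))%:C)).
    by move=> y; rewrite XE.
  by apply: csmooth_on_real; apply: fsm; exact: sw.
- move=> x; apply/matrixP => i j; rewrite !mxE !Xw.
  have /matrixP/(_ i j) := aw x; rewrite !mxE => ->.
  by rewrite fN rmorphN.
move=> m y Uy i j k.
have cd (v : 'rV[R]_n) a b : cderive v (fun y => local_form X m y a b) y =
    (f (cderive v (fun y => local_form w m y a b) y))%:C.
  rewrite -[in RHS]fder -cderive_real; congr (cderive _ _ _).
  by apply/funext => z; exact: XE.
by rewrite !cd -!rmorphD -!fD cw // f0.
Qed.

(** Changes of coordinates have real Jacobians, so taking real and imaginary parts commutes with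
    passing to local forms and with differentiation. *)
Lemma closed_two_form_parts (w X Y : formField M) : closed_two_form w ->
  (forall x, w x = X x + 'i%C *: Y x) ->
  (forall x, conjM (X x) = X x) -> (forall x, conjM (Y x) = Y x) ->
  closed_two_form X /\ closed_two_form Y.
Proof.
move=> cw wE cX cY.
pose Xr x := map_mx (@complex.Re R) (X x); pose Yr x := map_mx (@complex.Re R) (Y x).
have XE x : X x = toC (Xr x) by rewrite toC_Re.
have YE x : Y x = toC (Yr x) by rewrite toC_Re.
have lX m y : exists A, local_form X m y = toC A /\ exists B, local_form Y m y = toC B /\
    local_form w m y = toC A + 'i%C *: toC B.
  pose Jm := jacobian (phi (psi m y) \o psi m) y.
  exists (Jm *m Xr (psi m y) *m Jm^T); split; first by rewrite /local_form XE toC_congr.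
  exists (Jm *m Yr (psi m y) *m Jm^T); split; first by rewrite /local_form YE toC_congr.
  by rewrite /local_form wE XE YE mulmxDr mulmxDl -scalemxAr -scalemxAl !toC_congr.
have entry (A D : 'M[R]_n) i j : (toC A + 'i%C *: toC D) i j = A i j +i* D i j.
  by apply/eqP; rewrite !mxE eq_complex /= !mul0r !mul1r subr0 !add0r !addr0 !eqxx.
split.
- apply: (@closed_two_form_real (@complex.Re R) w X) => //.
  + by move=> [? ?] [? ?].
  + by move=> [? ?].
  + by move=> V U F [].
  + by move=> m y i j; have [A [-> [D [_ ->]]]] := lX m y; rewrite entry mxE.
  + by move=> x i j; rewrite wE XE YE entry mxE.
apply: (@closed_two_form_real (@complex.Im R) w Y) => //.
+ by move=> [? ?] [? ?].
+ by move=> [? ?].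
+ by move=> V U F [].
+ by move=> m y i j; have [A [_ [D [-> ->]]]] := lX m y; rewrite entry mxE.
+ by move=> x i j; rewrite wE XE YE entry mxE.
Qed.

End ClosedForms.

(** The values at 0 and infinity are omega_1 + i omega_2 and omega_1 - i omega_2; the value at -1 is
    omega_3 + i omega_1 and supplies the third form. *)
Lemma hk_varpi_inj (R : realType) (V W : Type) (D : hkData V) (E : hkData (R := R) W) s t u w :
  (forall zeta, hk_varpi D zeta s t = hk_varpi E zeta u w) ->
  [/\ hk_omega1 D s t = hk_omega1 E u w, hk_omega2 D s t = hk_omega2 E u w &
      hk_omega3 D s t = hk_omega3 E u w].
Proof.
move=> e; have := e (aff 0); have := e None; have := e (aff (-1)); rewrite /hk_varpi.
move: (hk_omega1 D s t) (hk_omega2 D s t) (hk_omega3 D s t) (hk_omega1 E u w) => a b c a'.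
move: (hk_omega2 E u w) (hk_omega3 E u w) => b' c'.
rewrite /pencil /aff eqxx oppr_eq0 oner_eq0 => e3 em ep.
have ea : a = a'.
  have : 2 * a = 2 * a'.
    by transitivity (a + 'i%C * b + (a - 'i%C * b)); [ring | rewrite ep em; ring].
  by move/(mulfI (two_neq0 (R := R))).
have eb : b = b' by move: ep; rewrite ea => /addrI/(mulfI i_neq0).
by split=> //; move: e3; rewrite ea eb => /addIr/addrI.
Qed.

(** * From the pointwise results to the family on the manifold *)

Section TwistorFamily.
Context {R : realType} {n : nat} {M : smoothManifold R n}.
Local Notation C := R[i].
Context {wp w3 : formField M}.
Local Notation wm := (fun x => conjM (wp x)).
Context (w3_real : forall x, conjM (w3 x) = w3 x).
Context (wp_symplectic : holomorphic_symplectic wp).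
Context (varpi_symplectic : forall z : C, z != 0 ->
  holomorphic_symplectic (varpi wp w3 wm (aff z))).

Lemma varpi0 x : varpi wp w3 wm (aff 0) x = wp x.
Proof. exact: pencil0. Qed.

(** The assumptions cover 0 and the nonzero scalars; at infinity the form is the conjugate of [wp],
    and splitting is invariant under conjugation. *)
Lemma family_split x zeta : split_system (varpi wp w3 wm zeta x)
  (T10 (varpi wp w3 wm zeta x)) (T01 (varpi wp w3 wm zeta x))
  (pr10 (varpi wp w3 wm zeta x)) (pr01 (varpi wp w3 wm zeta x))
  (toC (Jz wp w3 wm zeta x)).
Proof.
have [[_ wp_anti _] wp_splits] := wp_symplectic.
case: zeta => [z|]; last first.
  apply: split_systemP; first by rewrite /varpi /= -conjMT wp_anti conjMN.
  exact: splits_conj (wp_splits x).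
rewrite -/(aff z); have [->|/varpi_symplectic[[_ anti _] spl]] := eqVneq z 0.
  by apply: split_systemP; rewrite varpi0.
by apply: split_systemP.
Qed.

Lemma family_pseudo_hyperkaehler :
  pseudo_hyperkaehler (gM wp w3 wm) (w1 wp wm) (w2 wp wm) w3
    (J1 wp w3 wm) (J2 wp w3 wm) (J3 wp w3 wm).
Proof.
have sys x := family_split x.
have r1 x : conjM (w1 wp wm x) = w1 wp wm x by exact: W1_real.
have r2 x : conjM (w2 wp wm x) = w2 wp wm x by exact: W2_real.
have [cl1 cl2] : closed_two_form (w1 wp wm) /\ closed_two_form (w2 wp wm).
  apply: (closed_two_form_parts wp_symplectic.1) => // x; exact: Wp_E.
have N1 : -1 != 0 :> C by rewrite oppr_eq0 oner_eq0.
(* [w3] is closed as the real part of the form at zeta = -1, which is w3 + i w1. *)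
have [cl3 _] : closed_two_form w3 /\ closed_two_form (w1 wp wm).
  apply: (closed_two_form_parts (varpi_symplectic N1).1) => // x; exact: pencil_N1.
have real_eq (X Y : 'M[R]_n) : toC X = toC Y -> X = Y := @toC_inj _ _ _ X Y.
have toCN (X : 'M[R]_n) : toC (- X) = - toC X.
  by apply/matrixP => i j; rewrite !mxE rmorphN.
have toC1 : toC (1%:M : 'M[R]_n) = 1%:M by exact: map_mx1.
split.
- move=> x; split; first exact: (metric_real (w3_real x) (sys x)).
    exact: (metric_sym (w3_real x) (sys x)).
  exact: (metric_unit (w3_real x) (sys x)).
- have W x := W_I (w3_real x) (sys x); split.
  + split; [exact: cl1 | move=> x; split; [exact: r1 | by have [u _ _ _] := W x]].
  + split; [exact: cl2 | move=> x; split; [exact: r2 | by have [_ u _ _] := W x]].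
  + split; [exact: cl3 | move=> x; split; [exact: w3_real | by have [_ _ u _] := W x]].
- move=> x; split; apply: toC_inj; rewrite toCM toCN toC1; exact: (I_sqr (sys x)).
- move=> x; have [[e1 e2 e3] [f1 f2 f3]] := quaternion_relations (w3_real x) (sys x).
  split; split; apply: toC_inj; rewrite toCM ?toCN.
  + exact: e1.
  + exact: e2.
  + exact: e3.
  + exact: f1.
  + exact: f2.
  + exact: f3.
- move=> x; have [e1 e2 e3] := metric_forms (w3_real x) (sys x).
  by split; [exact: e1 | exact: e2 | exact: e3].
Qed.

Lemma constant_section_holomorphic x : holomorphic_section_Z wp w3 wm (sM x).
Proof.
split=> // c _ p; split; first exact: cvg_cst.
  exists setT; first exact: filterT.
  by split; [exact: openT | move=> k; exact: (Ck_on_cst k setT (phi x x))].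
by move=> h; rewrite /JZ /= !derive_cst mul0mx.
Qed.

Section Point.
Context (x : M).
Local Notation K := (fun zeta => T10 (varpi wp w3 wm zeta x)).
Local Notation L := (fun zeta => T01 (varpi wp w3 wm zeta x)).
Local Notation P := (fun zeta => pr10 (varpi wp w3 wm zeta x)).
Local Notation Q := (fun zeta => pr01 (varpi wp w3 wm zeta x)).
Local Notation Jr := (fun zeta => Jz wp w3 wm zeta x).
Local Notation S := (tangent_section wp w3 wm x).
Local Notation a_ u := (toC u *m pr10 (varpi wp w3 wm (aff 0) x)).
Local Notation H0 := (H0R wp w3 wm x).

Lemma system_at : forall zeta, split_system (pencil (wp x) (w3 x) (conjM (wp x)) zeta)
  (K zeta) (L zeta) (P zeta) (Q zeta) (toC (Jr zeta)).
Proof. exact: (family_split x). Qed.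

Let sys := system_at.
Let w3r := w3_real x.

Lemma T10_varpi0 : T10 (varpi wp w3 wm (aff 0) x) = T10 (wp x).
Proof. by rewrite varpi0. Qed.
Lemma T01_varpi0 : T01 (varpi wp w3 wm (aff 0) x) = T01 (wp x).
Proof. by rewrite varpi0. Qed.

Lemma cotangentE tau : cotangent10 wp x tau = (L (aff 0) *m tau = 0).
Proof. by rewrite /cotangent10 -T01_varpi0. Qed.

Lemma H0RE s : H0 s <-> H0_like (K := K) (L := L) (Jr := Jr) s.
Proof.
split=> -[ns rs hs]; split; [exact: ns | exact: rs | | exact: ns | exact: rs |].
  by move=> tau Lt; apply: hs; rewrite cotangentE; exact: Lt.
by move=> tau; rewrite cotangentE => Lt; exact: (hs tau Lt).
Qed.

Lemma representedE s v : represented_by wp w3 wm x s v <->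
  represented_like (K := K) (L := L) (Jr := Jr) s v.
Proof.
split=> rep z; have [vK vE] := rep z; split.
- by rewrite T10_varpi0.
- by move=> tau Lt; apply: vE; rewrite cotangentE.
- by rewrite -T10_varpi0.
- by move=> tau; rewrite cotangentE => Lt; exact: vE.
Qed.

Lemma tangent_section_H0 u : H0 (S u).
Proof. by apply/H0RE; exact: (section_H0 w3r sys u). Qed.

Lemma H0_tangent_section s : H0 s -> exists u, s = S u.
Proof. by move/H0RE/(H0_section w3r sys). Qed.

Lemma tangent_section_inj zeta u v : S u zeta = S v zeta -> u = v.
Proof. exact: (section_at_inj sys). Qed.

Lemma family_normal_bundle d : n = d.*2 -> normal_bundle_O1 wp w3 wm x d.
Proof.
move=> nd; split.
- by rewrite -T10_varpi0; apply: double_inj; rewrite (rank_K (sys (aff 0))).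
- move=> z v; rewrite -T10_varpi0 => vK.
  have [y [[yK yE] yU]] := dual_frame_iso w3r sys z vK.
  exists y; split; first by split; [exact: yK | move=> tau; rewrite cotangentE; exact: yE].
  move=> y' [y'K y'E]; apply: yU; split; first exact: y'K.
  by move=> tau Lt; apply: y'E; rewrite cotangentE; exact: Lt.
move=> w v; rewrite -T10_varpi0 => vK.
have [y [[yK yE] yU]] := dual_frame_inf_iso w3r sys w vK.
exists y; split; first by split; [exact: yK | move=> tau; rewrite cotangentE; exact: yE].
move=> y' [y'K y'E]; apply: yU; split; first exact: y'K.
by move=> tau Lt; apply: y'E; rewrite cotangentE; exact: Lt.
Qed.

Lemma family_tangent_bij : set_bij setT H0 S.
Proof.
split; first by move=> u _; exact: tangent_section_H0.
- by move=> u v _ _ e; apply: (@tangent_section_inj (aff 0)); rewrite e.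
- by move=> s /H0_tangent_section[u ->]; exists u.
Qed.

Lemma tangent_section_linear (l : R) (u v : 'rV[R]_n) zeta :
  S (l *: u + v) zeta = l%:C *: S u zeta + S v zeta.
Proof.
rewrite /tangent_section scalemxAl -mulmxDl; congr (_ *m _).
by apply/matrixP => i k; rewrite !mxE rmorphD rmorphM.
Qed.

Local Notation J1C := (toC (J1 wp w3 wm x)).
Local Notation j := (fun a : 'rV[C]_n => conjM a *m J1C).

Lemma tangent_section_represented u :
  represented_by wp w3 wm x (S u) (fun z => a_ u - z *: j (a_ u)).
Proof. by apply/representedE; exact: (section_represented w3r sys u). Qed.

Lemma family_hklr_operator : hklr_operator wp w3 wm x j.
Proof.
split.
- by move=> a; rewrite -T10_varpi0; exact: (j_K0 w3r sys).
- by move=> l a b _ _; exact: (j_antilinear (Jr := Jr) l a b).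
- by move=> a _; exact: (j_sqr sys).
- move=> s ns; split=> [/H0_tangent_section[u ->]|[a]].
    exists (a_ u); last exact: tangent_section_represented.
    by rewrite -T10_varpi0; exact: (P0_K sys).
  rewrite -T10_varpi0 => aK /representedE rep.
  have [u ue] := vector_of sys aK; rewrite -ue in rep.
  by rewrite (represented_section w3r sys ns rep); exact: tangent_section_H0.
- move=> a; rewrite -T10_varpi0 => aK; have [u <-] := vector_of sys aK.
  by exists (S u); [exact: tangent_section_H0 | exact: tangent_section_represented].
Qed.

Lemma hk_varpi_paper zeta (u w : 'rV[R]_n) :
  hk_varpi (paper_structure wp w3 wm x) zeta u w =
  bil (varpi wp w3 wm zeta x) (S u zeta) (S w zeta).
Proof.
have ep : bil (wp x) (toC u) (toC w) =
    bil (w1 wp wm x) (toC u) (toC w) + 'i%C * bil (w2 wp wm x) (toC u) (toC w).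
  by rewrite -bilZ -bilD; exact: (congr1 (fun X => bil X _ _) Wp_E).
have em : bil (conjM (wp x)) (toC u) (toC w) =
    bil (w1 wp wm x) (toC u) (toC w) - 'i%C * bil (w2 wp wm x) (toC u) (toC w).
  by rewrite -bilZ -bilN -bilD; congr (bil _ _ _); exact: Wm_E.
by rewrite [RHS](bil_section sys) bil_pencil ep em.
Qed.

Lemma paper_cplx zeta u :
  S (u *m Jz wp w3 wm zeta x) zeta = 'i%C *: S u zeta.
Proof. exact: (section_J sys). Qed.

Lemma paper_metric u w : hk_metric (paper_structure wp w3 wm x) u w =
  2^-1 * (bil (wp x) (a_ u) (j (a_ w)) - bil (wp x) (j (a_ u)) (a_ w)).
Proof. exact: (metric_bil w3r sys). Qed.

(** A left inverse of [S], defined on all functions because the operations of [hkData] are total. *)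
Definition vector_at_0 (s : P1 (R := R) -> 'rV[C]_n) : 'rV[R]_n :=
  map_mx (@complex.Re R) (s (aff 0) + conjM (s (aff 0))).

Lemma vector_at_0K u : vector_at_0 (S u) = u.
Proof.
apply: toC_inj; rewrite toC_Re; last by rewrite conjMD conjMK addrC.
by rewrite /tangent_section -(toC_P_conj sys).
Qed.

(** The structure on tangent vectors is transported through [vector_at_0]; its existence keeps the
    uniqueness statement from being vacuous. *)
Lemma family_hklr_exists : exists D, hklr_structure wp w3 wm x D.
Proof.
pose E := paper_structure wp w3 wm x; pose ev := vector_at_0.
exists (HkData (fun s t => hk_metric E (ev s) (ev t)) (fun s t => hk_omega1 E (ev s) (ev t))
  (fun s t => hk_omega2 E (ev s) (ev t)) (fun s t => hk_omega3 E (ev s) (ev t))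
  (fun zeta s => S (hk_cplx E zeta (ev s)))).
split.
- exists j; first exact: family_hklr_operator.
  move=> s t a b /H0_tangent_section[u ->] /H0_tangent_section[w ->] _ _.
  move=> /representedE/(represented_uniq w3r sys)[-> _].
  move=> /representedE/(represented_uniq w3r sys)[-> _] /=.
  by rewrite /ev !vector_at_0K; exact: paper_metric.
- move=> zeta s t /H0_tangent_section[u ->] /H0_tangent_section[w ->].
  by rewrite -hk_varpi_paper /hk_varpi /= /ev !vector_at_0K.
- move=> zeta s /H0_tangent_section[u ->]; split; first exact: tangent_section_H0.
  by rewrite /= /ev vector_at_0K paper_cplx.
Qed.

Lemma family_hklr_unique D : hklr_structure wp w3 wm x D ->
  hk_coincide S (paper_structure wp w3 wm x) D.
Proof.
move=> [[j' [_ _ _ jH _] Dg] Dv Dc].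
have SH := tangent_section_H0; have SN u : normal_section wp w3 wm x (S u) by case: (SH u).
have v_eq zeta u w : hk_varpi D zeta (S u) (S w) = hk_varpi (paper_structure wp w3 wm x) zeta u w.
  by rewrite Dv // hk_varpi_paper.
have om u w := hk_varpi_inj (fun zeta => v_eq zeta u w).
split; [|by move=> u w; have [] := om u w|by move=> u w; have [] := om u w
  |by move=> u w; have [] := om u w|].
(* The representatives come with the unknown operator [j']; uniqueness of coefficients identifies
   both [a] and [j' a], and likewise for [b]. *)
- move=> u w; have [a aK ra] := (jH (S u) (SN u)).1 (SH u).
  have [b bK rb] := (jH (S w) (SN w)).1 (SH w).
  rewrite (Dg _ _ _ _ (SH u) (SH w) aK bK ra rb).
  move/representedE/(represented_uniq w3r sys): ra => [-> ->].
  move/representedE/(represented_uniq w3r sys): rb => [-> ->].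
  by rewrite paper_metric.
(* Both sides are real holomorphic sections with the same value at this zeta, and one value
   determines such a section. *)
- move=> zeta u; have [H e] := Dc zeta _ (SH u).
  have [v Ev] := H0_tangent_section H; rewrite Ev; congr S.
  by apply: (@tangent_section_inj zeta); rewrite -Ev e paper_cplx.
Qed.

End Point.
End TwistorFamily.

Theorem mainTheorem3 (R : realType) (r : nat) (M : smoothManifold R (4 * r)%N)
    (wp w3 wm : formField M)
    (wp_symplectic : holomorphic_symplectic wp)
    (wm_conj : forall x : M, wm x = conjM (wp x))
    (w3_real : forall x : M, w3 x = conjM (w3 x))
    (varpi_symplectic : forall z : R[i], z != 0 ->
       holomorphic_symplectic (varpi wp w3 wm (aff z))) :
  pseudo_hyperkaehler (gM wp w3 wm) (w1 wp wm) (w2 wp wm) w3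
    (J1 wp w3 wm) (J2 wp w3 wm) (J3 wp w3 wm) /\
  injective (@sM R (4 * r)%N M) /\
  forall x : M,
    [/\ holomorphic_section_Z wp w3 wm (sM x) /\ real_section_Z (sM x),
        normal_bundle_O1 wp w3 wm x (2 * r)%N,
        set_bij setT (H0R wp w3 wm x) (tangent_section wp w3 wm x) /\
        (forall (l : R) (u v : 'rV[R]_(4 * r)) (zeta : P1),
           tangent_section wp w3 wm x (l *: u + v) zeta =
           l%:C *: tangent_section wp w3 wm x u zeta +
           tangent_section wp w3 wm x v zeta),
        exists D, hklr_structure wp w3 wm x D &
        forall D, hklr_structure wp w3 wm x D ->
          hk_coincide (tangent_section wp w3 wm x) (paper_structure wp w3 wm x) D].
Proof.
have wmE : wm = fun x => conjM (wp x) by apply/funext.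
rewrite {}wmE in wm_conj varpi_symplectic *.
have w3r x : conjM (w3 x) = w3 x by rewrite -w3_real.
split; first exact: family_pseudo_hyperkaehler.
split=> [x y /(congr1 (fun s : P1 -> Z => (s None).1))//|x].
split.
- by split; first exact: constant_section_holomorphic.
- by apply: family_normal_bundle => //; rewrite -mul2n mulnA.
- split; first exact: family_tangent_bij.
  exact: tangent_section_linear.
- exact: family_hklr_exists.
- exact: family_hklr_unique.
Qed.
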